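(* There is an algorithm which, given a median graph $G$ with $n$ vertices and $m$ edges, computes the partition of the edge set of $G$ into its $\Theta$-classes in $O(m)$ time.
   Context: All graphs are finite, simple, connected and undirected; $d(u,v)$ is the shortest-path distance and $I(u,v)=\{x: d(u,x)+d(x,v)=d(u,v)\}$ is the interval. A graph $G$ is a median graph if for every triple $x,y,z$ of vertices the set $I(x,y)\cap I(y,z)\cap I(z,x)$ consists of exactly one vertex. A square is a 4-cycle. Two edges $uv$ and $u'v'$ are in relation $\Theta_0$ if $uvv'u'$ is a square of $G$ in which $uv$ and $u'v'$ are opposite edges; $\Theta$ is the reflexive and transitive closure of $\Theta_0$, and its equivalence classes are the $\Theta$-classes. The graph is given by adjacency lists. *)

(* Defs.v *)
From mathcomp Require Import all_boot.

Set Implicit Arguments.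
Unset Strict Implicit.
Unset Printing Implicit Defensive.

Section Graph.

Variables (T : finType) (e : rel T).

(* The least length of a walk from u to v; it is #|T| when there is none,
   which does not happen in a connected graph. *)
Definition dist (u v : T) : nat :=
  find (fun k => [exists p : k.-tuple T, path e u p && (last u p == v)])
       (iota 0 #|T|).

Definition interval (u v : T) : {set T} :=
  [set x | dist u x + dist x v == dist u v].

(* The null graph does not count as connected. *)
Definition connected_simple_graph : Prop :=
  [/\ 0 < #|T|, symmetric e, irreflexive e & forall u v, connect e u v].

Definition median_graph : Prop :=
  connected_simple_graph /\
  forall x y z, #|interval x y :&: interval y z :&: interval z x| = 1.

Definition edges : {set {set T}} := [set [set u; v] | u in T, v in e u].

Definition Theta0 (a b : {set T}) : bool :=
  [exists u, exists v, exists u', exists v',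
    [&& a == [set u; v], b == [set u'; v'] & ucycleb e [:: u; v; v'; u']]].

Definition Theta : rel {set T} := connect Theta0.

Definition Theta_classes : {set {set {set T}}} :=
  equivalence_partition Theta edges.

End Graph.

(* A random access machine, programmed in structured form, with finitely many
   registers and memory banks (a program names its registers and banks
   by literals).  Every step is charged 1.  The machine has words holding the
   naturals below W: an operation that reads or produces a larger number has
   no result, and a program in which this happens has no execution. *)

Inductive binop := Add | Sub | Ltn | Eqn.

Inductive expr :=
  | Const of nat
  | Reg of nat
  | Fetch of nat & expr               (* bank, address *)
  | Bin of binop & expr & expr.

Inductive cmd :=
  | Skip
  | Assign of nat & expr
  | Store of nat & expr & expr        (* bank, address, value *)
  | Seq of cmd & cmd
  | If of expr & cmd & cmd
  | While of expr & cmd.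

Record state := State { reg : nat -> nat; bank : nat -> nat -> nat }.

Definition upd (A : Type) (f : nat -> A) (i : nat) (v : A) : nat -> A :=
  fun j => if j == i then v else f j.

Definition set_reg (s : state) (r v : nat) : state :=
  State (upd (reg s) r v) (bank s).

Definition set_bank (s : state) (a i v : nat) : state :=
  State (reg s) (upd (bank s) a (upd (bank s a) i v)).

Definition binop_sem (o : binop) (x y : nat) : nat :=
  match o with
  | Add => x + y
  | Sub => x - y
  | Ltn => x < y
  | Eqn => x == y
  end.

Definition word (W v : nat) : option nat := if v < W then Some v else None.

Fixpoint eval (W : nat) (s : state) (x : expr) : option nat :=
  match x with
  | Const k => word W k
  | Reg r => word W (reg s r)
  | Fetch a y => obind (fun i => word W (bank s a i)) (eval W s y)
  | Bin o y z =>
      obind (fun i => obind (fun j => word W (binop_sem o i j)) (eval W s z))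
            (eval W s y)
  end.

Fixpoint expr_cost (x : expr) : nat :=
  match x with
  | Const _ | Reg _ => 1
  | Fetch _ y => (expr_cost y).+1
  | Bin _ y z => (expr_cost y + expr_cost z).+1
  end.

(* exec W c s s' t: started in s, the program c halts in s' after t steps. *)
Inductive exec (W : nat) : cmd -> state -> state -> nat -> Prop :=
  | ExecSkip s : exec W Skip s s 1
  | ExecAssign s r x v :
      eval W s x = Some v ->
      exec W (Assign r x) s (set_reg s r v) (expr_cost x).+1
  | ExecStore s a x y i v :
      eval W s x = Some i -> eval W s y = Some v ->
      exec W (Store a x y) s (set_bank s a i v)
        (expr_cost x + expr_cost y).+1
  | ExecSeq c1 c2 s s1 s2 t1 t2 :
      exec W c1 s s1 t1 -> exec W c2 s1 s2 t2 ->
      exec W (Seq c1 c2) s s2 (t1 + t2)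
  | ExecIf s x v c1 c2 s' t :
      eval W s x = Some v -> exec W (if v != 0 then c1 else c2) s s' t ->
      exec W (If x c1 c2) s s' (expr_cost x + t).+1
  | ExecWhileFalse s x c :
      eval W s x = Some 0 -> exec W (While x c) s s (expr_cost x).+1
  | ExecWhileTrue s x v c s1 s2 t1 t2 :
      eval W s x = Some v -> v != 0 ->
      exec W c s s1 t1 -> exec W (While x c) s1 s2 t2 ->
      exec W (While x c) s s2 (expr_cost x + t1 + t2).+1.

Section InputOutput.

Variables (n : nat) (e : rel 'I_n) (adj : 'I_n -> seq 'I_n).

(* The neighbours may be listed in any order. *)
Definition adjacency_lists : Prop :=
  forall v, uniq (adj v) /\ forall w, (w \in adj v) = e v w.

Definition lists : seq (seq nat) :=
  [seq [seq val w | w <- adj v] | v <- enum 'I_n].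

(* Register 0 holds n.  Bank 1 holds the concatenation of the adjacency
   lists, and the list of v occupies the addresses from bank 0 [v] up to,
   but excluding, bank 0 [v + 1].  All the rest is 0. *)
Definition input : state :=
  State (fun r => if r == 0 then n else 0)
    (fun a =>
       match a with
       | 0 => nth 0 (mkseq (fun i => sumn (take i (shape lists))) n.+1)
       | 1 => nth 0 (flatten lists)
       | _ => fun=> 0
       end).

(* The address in bank 1 of the occurrence of w in the list of v. *)
Definition slot (v w : 'I_n) : nat :=
  flatten_index (shape lists) v (index w (adj v)).

(* Register 1 holds the number of classes, and bank 2 holds, at the address
   of each entry of an adjacency list, the label of the class of that edge. *)
Definition labelled_class (s : state) (i : nat) : {set {set 'I_n}} :=
  [set [set v; w] | v in 'I_n, w in e v & (bank s 2 (slot v w) == i)].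

Definition outputs_partition (s : state) (P : {set {set {set 'I_n}}}) : Prop :=
  [/\ forall v w, e v w -> bank s 2 (slot v w) < reg s 1,
      reg s 1 = #|P|
    & [set labelled_class s i | i : 'I_(reg s 1)] = P].

End InputOutput.

(* Main.v *)
Require Import Defs.
From mathcomp Require Import all_boot.
From mathcomp Require Import zify.

(* Orient every edge towards a root r, and call v below u when uv is an edge and
   v is nearer to r. The Theta-classes are the halfspaces {x | d x u < d x v}
   for v below u. Each halfspace has a unique gate, which is its vertex nearest
   to r and has a single neighbour below; number the classes in the
   breadth-first order of their gates. If M u is the largest number among the
   edges going down from u, then M u is also the largest number of a halfspace
   containing u, since a halfspace not bordering u contains a halfspace, with a
   gate of higher level, that borders u. Hence, when u has at least two
   neighbours below, the one across the edge numbered M u, say p u, is the one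
   with the least M; every other neighbour w below u satisfies M w = M u, and
   u, w, p w, p u is a square. So a single breadth-first search computes M, p
   and all numbers: uw gets the number of (p u)(p w), which is looked up in a
   matrix in constant time. No lexicographic search is needed. *)

Set Implicit Arguments.
Unset Strict Implicit.
Unset Printing Implicit Defensive.

(** * Distances *)

(** Squares cannot simply be enumerated: a hypercube has more than O(m) of them. Each edge must
    therefore get its label from one well-chosen square, whose opposite edge is already labelled and
    is located by two parent pointers instead of a search. Halfspaces make this provable: they turn
    [Theta], a transitive closure, into an equality of sets that squares preserve and that also
    fixes the direction of an edge relative to the root. Neither [parent] nor [max_label] may be
    computed from the labels of the edges at a vertex, since the labelling of those edges relies on
    them; both are read off from the least and greatest [max_label] among the neighbours below. The
    matrix is large in addresses but not in time, as only cells of edges are touched; its size is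
    what asks for words of order (n + m)^2. Connectedness gives n <= m + 1, which absorbs the cost
    per vertex. *)

Section Distance.

Variables (T : finType) (e : rel T).
Hypothesis e_sym : symmetric e.
Hypothesis e_conn : forall u v, connect e u v.

Local Notation d := (dist e).

Lemma dist_le_path u v p : path e u p -> last u p = v -> d u v <= size p.
Proof.
move=> ep lp; case: (ltnP (size p) #|T|) => [lt_p|le_p]; last first.
  apply: leq_trans le_p; rewrite -[X in _ <= X](size_iota 0).
  exact: find_size.
rewrite leqNgt; apply/negP => /(before_find 0).
rewrite nth_iota // add0n => /existsP[]; exists (in_tuple p).
by rewrite /= ep lp eqxx.
Qed.

Lemma dist_path u v : exists p, [/\ path e u p, last u p = v & size p = d u v].
Proof.
have /connectP[p0 ep0 ->] := e_conn u v.
case: (shortenP ep0) => p ep uq_p _.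
have lt_p : size p < #|T|.
  by have := max_card (mem (u :: p)); rewrite (card_uniqP uq_p).
set P := fun k => [exists q : k.-tuple T, path e u q && (last u q == last u p)].
have hasP : has P (iota 0 #|T|).
  apply/hasP; exists (size p); first by rewrite mem_iota.
  by apply/existsP; exists (in_tuple p); rewrite /= ep eqxx.
have := nth_find 0 hasP; have := hasP; rewrite has_find size_iota => ltf.
rewrite nth_iota // add0n => /existsP[q /andP[eq /eqP lq]].
by exists q; split=> //; rewrite size_tuple.
Qed.

Lemma dist0 u : d u u = 0.
Proof. by apply/eqP; rewrite -leqn0; apply: (@dist_le_path u u [::]). Qed.

Lemma dist_eq0 u v : d u v = 0 -> u = v.
Proof.
by have [p [_ <- <-]] := dist_path u v; case: p.
Qed.

Lemma dist_triangle u v w : d u w <= d u v + d v w.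
Proof.
have [p [ep lp <-]] := dist_path u v; have [q [eq lq <-]] := dist_path v w.
rewrite -size_cat; apply: dist_le_path; first by rewrite cat_path ep lp.
by rewrite last_cat lp.
Qed.

Lemma dist_sym u v : d u v = d v u.
Proof.
suff le_d x y : d x y <= d y x by apply/eqP; rewrite eqn_leq !le_d.
have [p [ep lp <-]] := dist_path y x.
rewrite -(size_belast y p) -size_rev; apply: dist_le_path; last first.
  by case: p lp {ep} => [|z p] //= _; rewrite rev_cons last_rcons.
by rewrite -lp rev_path; apply: sub_path ep => a b; rewrite e_sym.
Qed.

Lemma dist_edge u v : e u v -> d u v <= 1.
Proof. by move=> euv; apply: (@dist_le_path u v [:: v]) => //=; rewrite euv. Qed.

Lemma dist1_edge u v : d u v = 1 -> e u v.
Proof.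
have [p [ep lp <-]] := dist_path u v.
by case: p ep lp => [|w [|]] //=; rewrite andbT => euw <-.
Qed.

Lemma dist_step u v k : d u v = k.+1 -> exists2 w, e u w & d w v = k.
Proof.
have [p [ep lp sz_p]] := dist_path u v; rewrite -sz_p.
case: p ep lp sz_p => [//|w p] /= /andP[euw ep] lp sz_p [sz_k].
exists w => //; apply/eqP; rewrite eqn_leq -{1}sz_k (dist_le_path ep lp) /=.
by have := dist_triangle u w v; have := dist_edge euw; lia.
Qed.

End Distance.

Lemma sorted_relpre_nth (T : Type) (f : T -> nat) (x : T) (s : seq T) i j :
  sorted (relpre f leq) s -> i <= j -> j < size s ->
  f (nth x s i) <= f (nth x s j).
Proof.
move=> srt le_ij lt_j; have tr : transitive (relpre f leq) by move=> ? ? ?; apply: leq_trans.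
apply: (sorted_leq_nth tr (fun u => leqnn (f u)) x srt); rewrite ?inE //.
exact: leq_ltn_trans lt_j.
Qed.

(** * Halfspaces of a median graph *)

Section MedianGraph.

Variables (T : finType) (e : rel T).
Hypothesis e_median : median_graph e.

Local Notation d := (dist e).

Let e_sym : symmetric e. Proof. by have [[]] := e_median. Qed.
Let e_irr : irreflexive e. Proof. by have [[]] := e_median. Qed.
Let e_conn : forall u v, connect e u v. Proof. by have [[]] := e_median. Qed.
Let d_sym := dist_sym e_sym e_conn.
Let d_tri := dist_triangle e_conn.
Let d_edge u v := @dist_edge T e u v.

Lemma medianP x y z :
  exists m, [/\ d x m + d m y = d x y, d y m + d m z = d y z
              & d z m + d m x = d z x].
Proof.
have /eqP/cards1P[m Em] := e_median.2 x y z.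
have : m \in [set m] by rewrite inE.
by rewrite -Em !inE => /andP[/andP[/eqP? /eqP?] /eqP?]; exists m.
Qed.

Lemma median_unique x y z m m' :
  d x m + d m y = d x y -> d y m + d m z = d y z -> d z m + d m x = d z x ->
  d x m' + d m' y = d x y -> d y m' + d m' z = d y z ->
  d z m' + d m' x = d z x -> m = m'.
Proof.
have /eqP/cards1P[c Ec] := e_median.2 x y z => *.
have: m \in [set c] by rewrite -Ec !inE; apply/andP; split; [apply/andP; split|]; apply/eqP.
have: m' \in [set c] by rewrite -Ec !inE; apply/andP; split; [apply/andP; split|]; apply/eqP.
by rewrite !inE => /eqP-> /eqP->.
Qed.

(** The median of [x], [u], [v] lies on the edge [uv], so it is one of the ends, and the other end
    is one step farther from [x]: median graphs are bipartite. *)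
Lemma dist_adjacent u v x : e u v -> d u x = (d v x).+1 \/ d v x = (d u x).+1.
Proof.
move=> euv; have [m [m1 m2 m3]] := medianP x u v.
have duv : d u v = 1.
  apply/eqP; rewrite eqn_leq d_edge // lt0n; apply/eqP => /(dist_eq0 e_conn) Euv.
  by rewrite Euv e_irr in euv.
have := d_sym u x; have := d_sym v x; have := d_sym v u.
have [/(dist_eq0 e_conn) Em|/(dist_eq0 e_conn) Em] : d u m = 0 \/ d m v = 0 by lia.
  by subst m; lia.
by subst m; lia.
Qed.

Lemma dist_two u v w : e u v -> e u w -> v != w -> d v w = 2.
Proof.
move=> euv euw neq_vw; have := d_edge euv; have := d_edge euw.
have := d_tri v u w; have := dist_adjacent w euv; have := dist_adjacent u euw.
rewrite (d_sym v u) dist0 (d_sym w u); case: (posnP (d v w)) => [|].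
  by move/(dist_eq0 e_conn)=> E; rewrite E eqxx in neq_vw.
lia.
Qed.

(** The fourth corner is the median of [v], [w], [x]: as [v] and [w] are at distance 2 and equally
    far from [x], it is adjacent to both and one step nearer to [x]. *)
Lemma quadrangle u v w x :
  e u v -> e u w -> v != w -> d u x = (d v x).+1 -> d u x = (d w x).+1 ->
  exists y, [/\ e v y, e w y & d v x = (d y x).+1].
Proof.
move=> euv euw neq_vw dv dw; have dvw := dist_two euv euw neq_vw.
have [m [m1 m2 m3]] := medianP v w x.
have := d_sym x v; have := d_sym m v; have := d_sym m x; have := d_sym m w => *.
by exists m; split; [apply: (dist1_edge e_conn)..|]; lia.
Qed.

(** [a], [b], [c] are pairwise at distance 2, so [v] and [w] are both medians of them. *)
Lemma no_K23 v w a b c :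
  e v a -> e w a -> e v b -> e w b -> e v c -> e w c ->
  a != b -> b != c -> c != a -> v = w.
Proof.
move=> va wa vb wb vc wc ab bc ca.
have d1 u x : e u x -> d u x = 1.
  move=> eux; apply/eqP; rewrite eqn_leq d_edge // lt0n.
  by apply/eqP => /(dist_eq0 e_conn) E; rewrite E e_irr in eux.
have d1' u x : e u x -> d x u = 1 by move=> /d1; rewrite d_sym.
by apply: (@median_unique a b c);
  rewrite ?(dist_two va vb ab) ?(dist_two vb vc bc) ?(dist_two vc va ca)
    ?(d1 _ _ va) ?(d1 _ _ vb) ?(d1 _ _ vc) ?(d1' _ _ va) ?(d1' _ _ vb) ?(d1' _ _ vc)
    ?(d1 _ _ wa) ?(d1 _ _ wb) ?(d1 _ _ wc) ?(d1' _ _ wa) ?(d1' _ _ wb) ?(d1' _ _ wc).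
Qed.

(** The Djokovic halfspace of an oriented edge; bipartiteness excludes ties, so reversing the edge
    gives the complement. *)
Definition half (a b : T) : {set T} := [set x | d a x < d b x].

Lemma square_half a b b' a' :
  e a b -> e b b' -> e b' a' -> e a' a -> a != b' -> b != a' ->
  half a b = half a' b'.
Proof.
suff sub p q q' p' : e p q -> e q q' -> e q' p' -> e p' p -> p != q' -> q != p' ->
    half p q \subset half p' q'.
  move=> *; apply/eqP; rewrite eqEsubset !sub //;
  by rewrite 1?e_sym // eq_sym.
move=> pq qq' q'p' p'p npq' nqp'; apply/subsetP => x; rewrite !inE => ltx.
have := dist_adjacent x pq; have := dist_adjacent x qq'.
have := dist_adjacent x q'p'; have := dist_adjacent x p'p => h1 h2 h3 h4.
case: ltnP => // ge; exfalso.
have {h1 h2 h3 h4 ltx ge} [dq dq' dp'] :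
    [/\ d q x = (d p x).+1, d q' x = d p x & d p' x = (d p x).+1] by split; lia.
have qp : e q p by rewrite e_sym.
(* A vertex [x] in the difference makes [p] and [q'] both nearer to [x] than [q]. Their common
   neighbour [y] towards [x] is then a third one besides [q] and [p']. *)
have [||y [py q'y dy]] := quadrangle (x := x) qp qq' npq'; rewrite ?dq' //.
suff : p = q' by apply/eqP.
apply: (@no_K23 p q' q p' y) => //; rewrite 1?e_sym //.
  by apply/eqP => E; rewrite E dy in dp'; clear -dp'; lia.
by apply/eqP => E; rewrite -E dy in dq; clear -dq; lia.
Qed.

(** A ladder of squares joins [uv] to [ab]: [v] and a neighbour [a1] of [u] nearer to [a] are both
    nearer to [b] than [u] is, so [quadrangle] supplies the next rung [a1 b1]. The induction is on
    the distance from [u] to [a]. *)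
Lemma half_edge a b u v :
  e a b -> e u v -> u \in half a b -> v \notin half a b ->
  half u v = half a b /\ Theta e [set u; v] [set a; b].
Proof.
move=> ab uv; rewrite !inE -leqNgt => lt_u le_v.
have := dist_adjacent u ab; have := dist_adjacent v ab.
have := dist_adjacent a uv; have := dist_adjacent b uv.
rewrite (d_sym u a) (d_sym u b) (d_sym v a) (d_sym v b) => h1 h2 h3 h4.
have {lt_u le_v h1 h2 h3 h4} :
    [/\ d u a = d a u, d u b = (d a u).+1, d v b = d a u & d v a = (d a u).+1].
  by rewrite (d_sym u a) (d_sym u b) (d_sym v a) (d_sym v b); split; lia.
move: (d a u) => k; elim: k u v uv => [|k IHk] u v uv [ua ub vb va].
  by rewrite (dist_eq0 e_conn ua) (dist_eq0 e_conn vb); split=> //; apply: connect0.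
have [a1 ua1 da1] := dist_step e_conn ua.
have nva1 : v != a1 by apply/eqP => E; move: va; rewrite E; lia.
have a1b : d a1 b = k.+1.
  have := dist_adjacent b ua1; have := d_tri a1 a b; have := d_edge ab; lia.
have [||b1 [vb1 a1b1 db1]] := @quadrangle u v a1 b uv ua1 nva1; try lia.
have b1a : d b1 a = k.+1.
  have := dist_adjacent a vb1; have := dist_adjacent a a1b1; lia.
have nub1 : u != b1 by apply/eqP => E; move: ub; rewrite E; lia.
have [|<- Th] := IHk a1 b1 a1b1; first by rewrite vb in db1; case: db1.
split; first by apply: square_half; rewrite // e_sym.
apply: connect_trans Th; apply: connect1.
apply/existsP; exists u; apply/existsP; exists v.
apply/existsP; exists a1; apply/existsP; exists b1; rewrite !eqxx /= /ucycleb /= uv vb1.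
rewrite (e_sym b1) a1b1 (e_sym a1) ua1 /= !inE !negb_or nva1 nub1 andbT /=.
have neq x y : e x y -> x != y by move=> exy; apply/eqP => E; rewrite E e_irr in exy.
by rewrite !neq // e_sym.
Qed.

Lemma mem_halfC a b x : e a b -> (x \in half b a) = (x \notin half a b).
Proof. by move=> ab; rewrite !inE; have := dist_adjacent x ab; lia. Qed.

Lemma half_crossing a b m y :
  m \notin half a b -> y \in half a b ->
  exists v u, [/\ e v u, v \notin half a b, u \in half a b
                & d m v + (d u y).+1 = d m y].
Proof.
move: {-1}(d m y) (erefl (d m y)) => k; elim: k m => [|k IHk] m dmy mh yh.
  by rewrite (dist_eq0 e_conn dmy) yh in mh.
have [w mw dwy] := dist_step e_conn dmy.
have [wh|wh] := boolP (w \in half a b).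
  by exists m, w; rewrite dist0 dwy.
have [v [u [vu vh uh E]]] := IHk w dwy wh yh.
exists v, u; split=> //; have := d_edge mw; have := d_tri m w v.
have := d_edge vu; have := d_tri m v y; have := d_tri v u y; lia.
Qed.

(** A geodesic that left the halfspace would re-enter it across an edge [vu]. By [half_edge] that
    edge defines the same halfspace, so [x] is nearer to [u] than to [v], and the detour through [v]
    is not shortest. *)
Lemma half_convex a b x y m :
  e a b -> x \in half a b -> y \in half a b -> d x m + d m y = d x y ->
  m \in half a b.
Proof.
move=> ab xh yh xmy; apply/negPn/negP => mh.
have [v [u [vu vh uh E]]] := half_crossing mh yh.
rewrite e_sym in vu; have [Eh _] := half_edge ab vu uh vh.
move: xh; rewrite -Eh inE (d_sym u) (d_sym v).
have := d_tri x m v; have := d_tri x u y; lia.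
Qed.

(** * Levels from a root: gates and cones *)

Section Rooted.

Variable r : T.

Definition below (u : T) : {set T} := [set v | e u v & d r v < d r u].

Definition cone (c : T) : {set T} := [set y | d r c + d c y == d r y].

(** A test the program can make locally; [gate_half] and [half_gate] show that it selects the
    vertices of the halfspaces nearest to the root. *)
Definition gate (c : T) : bool := #|below c| == 1.

Lemma belowP u v : v \in below u -> e u v /\ d r u = (d r v).+1.
Proof.
rewrite inE => /andP[uv lt]; split=> //; have := dist_adjacent r uv.
rewrite (d_sym u) (d_sym v); lia.
Qed.

Lemma below_quadrangle u v w :
  v \in below u -> w \in below u -> v != w ->
  exists x, [/\ x \in below v, x \in below w, half u v = half w x
              & half u w = half v x].
Proof.
move=> /belowP[uv dv] /belowP[uw dw] nvw.
have [||x [vx wx dx]] := @quadrangle u v w r uv uw nvw;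
  rewrite 1?(d_sym _ r) 1?(d_sym _ r) //.
have nux : u != x by apply/eqP => E; move: dx; rewrite -E !(d_sym _ r); lia.
rewrite !(d_sym _ r) in dx.
exists x; rewrite !inE vx wx; split; try lia.
  by apply: square_half; rewrite // e_sym.
by apply: square_half; rewrite // 1?e_sym // eq_sym.
Qed.

Lemma below_half u v :
  v \in below u -> [/\ u \in half u v, v \notin half u v & r \notin half u v].
Proof.
move=> /belowP[uv dv]; rewrite !inE !dist0 !(d_sym _ r).
by have := dist_adjacent u uv; rewrite dist0; split; lia.
Qed.

(** [w] lies outside [half u w], which is [half u v], so it is strictly nearer to [v] than to its
    neighbour [u], that is, at distance 0 from [v]. *)
Lemma half_below_inj u v w :
  v \in below u -> w \in below u -> half u v = half u w -> v = w.
Proof.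
move=> vu wu E; have [_ wh _] := below_half wu; move: wh; rewrite -E inE -leqNgt => ?.
have [uw _] := belowP wu; have := d_edge uw => ?.
have [uv _] := belowP vu.
have := dist_adjacent w uv => ?; apply: (dist_eq0 e_conn); lia.
Qed.

Lemma below_exists u : u != r -> exists v, v \in below u.
Proof.
case E: (d u r) => [|k]; first by rewrite (dist_eq0 e_conn E) eqxx.
have [v uv dv] := dist_step e_conn E.
by exists v; rewrite inE uv !(d_sym r) E dv /=.
Qed.

Lemma below_root : below r = set0.
Proof. by apply/setP=> v; rewrite !inE dist0 andbF. Qed.

Lemma mem_cone c : c \in cone c. Proof. by rewrite inE dist0 addn0. Qed.

Lemma cone_inj : injective cone.
Proof.
move=> c c' E; have := mem_cone c; have := mem_cone c'; rewrite E -{1}E !inE.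
by move=> /eqP h1 /eqP h2; apply: (dist_eq0 e_conn); lia.
Qed.

(** Take the median of [r], [c] and a vertex [y] of the halfspace. If it differed from [c], a step
    from [c] towards it would go down, hence to the only neighbour below, which is farther from
    [y]. *)
Lemma gate_half c v : gate c -> v \in below c -> half c v = cone c.
Proof.
move=> /cards1P[w Ew]; rewrite Ew inE => /eqP{v}->.
have /belowP[cw dw] : w \in below c by rewrite Ew inE.
apply/setP => y; rewrite !inE; apply/idP/eqP => [lt_y|Ey].
  have [m [m1 m2 m3]] := medianP r c y.
  have [Em|nmc] := eqVneq m c; first by rewrite Em (d_sym y c) (d_sym y r) (d_sym c r) in m3; lia.
  case dcm : (d c m) => [|k]; first by rewrite (dist_eq0 e_conn dcm) eqxx in nmc.
  have [p cp dp] := dist_step e_conn dcm.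
  have : p \in below c.
    rewrite inE cp; have := d_tri r m p; rewrite (d_sym m p) (d_sym m c) in m1 *; lia.
  rewrite Ew inE => /eqP Ep; rewrite Ep in dp.
  have := d_tri w m y; lia.
have := d_tri r w y; lia.
Qed.

(** While the upper end has a second neighbour below, [below_quadrangle] slides the edge down to a
    parallel one whose upper end has a lower level. *)
Lemma half_gate u v : v \in below u -> exists2 c, gate c & cone c = half u v.
Proof.
move: {-1}(d r u) (erefl (d r u)) => k; elim: k u v => [|k IHk] u v du vu.
  by have [_] := belowP vu; rewrite du.
have [gu|ngu] := boolP (gate u); first by exists u => //; rewrite (gate_half gu vu).
have [w wu nvw] : exists2 w, w \in below u & v != w.
  have : 0 < #|below u :\ v| by move: ngu; rewrite /gate (cardsD1 v) vu; lia.
  by case/card_gt0P => w; rewrite !inE eq_sym => /andP[? ?]; exists w; rewrite ?inE.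
have [x [_ xw -> _]] := below_quadrangle vu wu nvw.
by apply: IHk xw; have [_] := belowP wu; lia.
Qed.

Lemma cone_below c u :
  gate c -> u \in cone c ->
  exists2 v, v \in below u & half u v = cone c \/
    exists c', [/\ gate c', cone c' = half u v & d r c < d r c'].
Proof.
move=> gc uc; have /cards1P[p Ep] := gc.
have pc : p \in below c by rewrite Ep inE.
have [cp _] := belowP pc; have pc' := cp; rewrite e_sym in pc'.
have Eh := gate_half gc pc; have [_ _ rh] := below_half pc.
rewrite -Eh in uc *.
(* [y] is the vertex nearest to [u] in the complementary halfspace. By convexity it lies between [u]
   and every vertex of that side, in particular [r], so the first step [v] towards it goes down. *)
pose y := [arg min_(y < r | y \notin half c p) d u y].
have [yh ymin] : y \notin half c p /\ forall z, z \notin half c p -> d u y <= d u z.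
  by rewrite /y; case: arg_minnP.
move: y => y in yh ymin.
have near m : m \notin half c p -> d u m + d m y = d u y -> m = y.
  by move=> /ymin le_m E; apply: (dist_eq0 e_conn); lia.
have convC x z m : x \notin half c p -> z \notin half c p ->
    d x m + d m z = d x z -> m \notin half c p.
  by rewrite -!(mem_halfC _ cp); apply: half_convex.
have yI : d u y + d y r = d u r.
  have [m [m1 m2 m3]] := medianP u y r.
  suff Em : m = y by rewrite -Em addnC (d_sym m r) (d_sym u m) (d_sym u r).
  by apply: near => //; apply: (convC y r).
case duy: (d u y) => [|k]; first by rewrite -(dist_eq0 e_conn duy) uc in yh.
have [v uv dvy] := dist_step e_conn duy.
have vu : v \in below u.
  rewrite inE uv !(d_sym r); have := d_tri v y r; lia.
exists v => //; case: (boolP (v \in half c p)) => vh; last first.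
  by left; have [] := half_edge cp uv uc vh.
right; have [c' gc' Ec'] := half_gate vu.
(* A vertex [b] outside [half c p] is reached from [u] through [y], hence by a geodesic starting
   with [v], so it is not in [half u v]. *)
have sub : half u v \subset half c p.
  apply/subsetP => b bg; apply/negPn/negP => bh.
  have [m [m1 m2 m3]] := medianP u b y.
  have Em : m = y.
    apply: near; [by apply: convC m2 |].
    by rewrite addnC (d_sym m y) (d_sym u m) (d_sym u y).
  move: bg; rewrite inE ltnNge -m1 Em duy -dvy addSn.
  by rewrite leqW // d_tri.
exists c'; split=> //.
(* Membership in [cone c] puts [c'] at least as high as [c]. Equality of levels would give [c' = c]
   and [half u v = half c p], although only the second contains [v]. *)
have : c' \in half c p by apply: (subsetP sub); rewrite -Ec' mem_cone.
rewrite Eh inE => /eqP E; case dcc : (d c c') E => [|j] E; last by rewrite -E addnS ltnS leq_addr.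
have [_ vg _] := below_half vu.
by move: vg; rewrite -Ec' -(dist_eq0 e_conn dcc) -Eh vh.
Qed.

End Rooted.
End MedianGraph.

(** * Numbering the Theta-classes *)

Section ThetaHalf.

Variables (T : finType) (e : rel T) (r : T).
Hypothesis e_median : median_graph e.

Let e_sym : symmetric e. Proof. by have [[]] := e_median. Qed.

Local Notation half := (half e).
Local Notation below := (below e r).

Lemma below_pair_inj u v a b :
  v \in below u -> b \in below a -> [set u; v] = [set a; b] -> u = a /\ v = b.
Proof.
move=> /(belowP e_median)[_ dv] /(belowP e_median)[_ db] E.
have : u \in [set a; b] by rewrite -E set21.
have : v \in [set a; b] by rewrite -E set22.
rewrite !inE => /pred2P[] Ev /pred2P[] Eu; subst; split=> //; lia.
Qed.

Lemma edge_orient u v : e u v -> v \in below u \/ u \in below v.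
Proof.
move=> uv; rewrite !inE uv e_sym uv /=; have := dist_adjacent e_median r uv.
have [[_ _ _ e_conn] _] := e_median.
rewrite !(dist_sym e_sym e_conn _ r); lia.
Qed.

Lemma edgesP x :
  reflect (exists u v, v \in below u /\ x = [set u; v]) (x \in edges e).
Proof.
apply: (iffP imset2P) => [[u v _ uv ->]|[u [v [vu ->]]]].
  rewrite unfold_in in uv; have [?|?] := edge_orient uv; first by exists u, v.
  by exists v, u; rewrite setUC.
by have [uv _] := belowP e_median vu; exists u v.
Qed.

(** Expresses the direction of an edge through its halfspace alone, so that opposite sides of a
    square inherit it from each other. *)
Lemma half_below_edge u v : e u v -> (v \in below u) = (r \notin half u v).
Proof.
move=> uv; rewrite !inE uv -leqNgt /=; have := dist_adjacent e_median r uv.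
have [[_ _ _ e_conn] _] := e_median.
rewrite !(dist_sym e_sym e_conn _ r); lia.
Qed.

(** One direction is the ladder of [half_edge]; in the other, every square of the chain preserves
    both the halfspace and the downward direction. *)
Lemma Theta_half u v a b :
  v \in below u -> b \in below a ->
  Theta e [set u; v] [set a; b] = (half u v == half a b).
Proof.
move=> vu ba; apply/idP/eqP => [|E]; last first.
  have [uh vh _] := below_half e_median vu; rewrite E in uh vh.
  have [uv _] := belowP e_median vu; have [ab _] := belowP e_median ba.
  by have [] := half_edge e_median ab uv uh vh.
case/connectP => s; elim: s u v vu => [|y s IHs] u v vu /=.
  by move=> _ E; have [<- <-] := below_pair_inj ba vu E.
case/andP => + ys E.
case/existsP => p /existsP[q /existsP[p' /existsP[q' /and3P[/eqP Ex /eqP Ey]]]].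
rewrite /ucycleb /= !inE !negb_or !andbT => /andP[/and4P[pq qq' q'p' p'p]].
case/and3P => /and3P[npq npq' npp'] /andP[nqq' nqp'] nq'p'.
have Eh : half p q = half p' q' by apply: square_half.
have Eh' : half q p = half q' p'.
  by apply: square_half; rewrite // 1?e_sym // eq_sym.
have [uv _] := belowP e_median vu.
have [] : (u = p /\ v = q) \/ (u = q /\ v = p).
  have : u \in [set p; q] by rewrite -Ex set21.
  have : v \in [set p; q] by rewrite -Ex set22.
  have nuv : u != v by apply/eqP => F; move: uv; rewrite F; have [[_ _ ->]] := e_median.
  by rewrite !inE => /pred2P[] Ev /pred2P[] Eu; subst; rewrite ?eqxx in nuv; auto.
- move=> [Eu Ev]; subst u v; rewrite Eh; apply: IHs; rewrite -?Ey //.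
  by rewrite half_below_edge 1?e_sym // -Eh -half_below_edge.
- move=> [Eu Ev]; subst u v; rewrite Eh'; apply: IHs; rewrite -1?[[set q'; p']]setUC -?Ey //.
  by rewrite half_below_edge // -Eh' -half_below_edge.
Qed.

End ThetaHalf.

(** * Labels in queue order, largest labels and parents *)

Section Labels.

Variables (T : finType) (e : rel T) (r : T) (q : seq T).
Hypothesis e_median : median_graph e.
Hypothesis q_all : forall v, v \in q.
Hypothesis q_sorted : sorted (relpre (dist e r) leq) q.

Local Notation l := (dist e r).
Local Notation half := (half e).
Local Notation below := (below e r).
Local Notation cone := (cone e r).
Local Notation gate := (gate e r).

Definition gates : seq T := filter gate q.

Definition label : T -> T -> nat :=
  locked (fun u v => index (half u v) (map cone gates)).

Definition max_label : T -> nat :=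
  locked (fun u => \max_(v in below u) label u v).

(** The defaults concern the root: its [max_label] is an empty maximum, 0, and it is its own parent.
    The program stores the same values. *)
Definition parent : T -> T :=
  locked (fun u => odflt u [pick v in below u | label u v == max_label u]).

Lemma labelE u v : label u v = index (half u v) (map cone gates).
Proof. by rewrite /label -lock. Qed.

Lemma max_labelE u : max_label u = \max_(v in below u) label u v.
Proof. by rewrite /max_label -lock. Qed.

Lemma parentE u :
  parent u = odflt u [pick v in below u | label u v == max_label u].
Proof. by rewrite /parent -lock. Qed.

Lemma leq_max_label u v : v \in below u -> label u v <= max_label u.
Proof.
by move=> vu; rewrite max_labelE; apply: (@leq_bigmax_cond _ (mem (below u)) (label u) v).
Qed.

Lemma gates_label u v :
  v \in below u ->
  exists2 c, [/\ c \in gates, gate c & cone c = half u v]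
    & label u v = index c gates.
Proof.
move=> vu; have [c gc Ec] := half_gate e_median vu.
have cgs : c \in gates by rewrite mem_filter gc q_all.
by exists c => //; rewrite labelE -Ec index_map //; apply: cone_inj.
Qed.

Lemma label_lt u v : v \in below u -> label u v < size gates.
Proof. by case/gates_label => c [cgs _ _] ->; rewrite index_mem. Qed.

Lemma label_inj u v a b :
  v \in below u -> b \in below a -> label u v = label a b -> half u v = half a b.
Proof.
move=> /gates_label[c [cgs _ <-] ->] /gates_label[c' [cgs' _ <-] ->] E.
by rewrite -(nth_index u cgs) E nth_index.
Qed.

Lemma label_gate u v : gate u -> v \in below u -> label u v = index u gates.
Proof.
move=> gu vu; rewrite labelE (gate_half e_median gu vu) index_map //.
exact: cone_inj.
Qed.

Lemma gates_index_lt c c' :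
  c \in gates -> c' \in gates -> l c < l c' -> index c gates < index c' gates.
Proof.
move=> cgs cgs' lt_l; rewrite ltnNge; apply/negP => le_i.
have gates_sorted : sorted (relpre l leq) gates.
  by apply: sorted_filter => // x y z; apply: leq_trans.
have := sorted_relpre_nth c gates_sorted le_i; rewrite index_mem !nth_index //.
move=> /(_ cgs).
by rewrite leqNgt lt_l.
Qed.

(** [cone_below] leaves two cases: the halfspace borders [u], or a bordering one has a gate of
    higher level, hence later in the queue and numbered higher. *)
Lemma label_le_max u a b : b \in below a -> u \in half a b -> label a b <= max_label u.
Proof.
move=> ba uh; have [c [cgs gc Ec] ->] := gates_label ba.
rewrite -Ec in uh; have [v vu] := cone_below e_median gc uh.
have le_v := leq_max_label vu.
have [c1 [cgs1 gc1 Ec1] Ev] := gates_label vu.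
case=> [Eh|[c' [gc' Ec' lt_c]]].
  rewrite Eh in Ec1; rewrite -(cone_inj e_median Ec1) -Ev; exact: le_v.
rewrite -Ec1 in Ec'; rewrite (cone_inj e_median Ec') in lt_c.
by apply: leq_trans le_v; rewrite Ev ltnW // gates_index_lt.
Qed.

Lemma parentP u v :
  v \in below u -> parent u \in below u /\ label u (parent u) = max_label u.
Proof.
move=> vu; rewrite parentE; case: pickP => [w /andP[wu /eqP]|no] //=.
have [w wu Ew] : exists2 w, w \in below u & max_label u = label u w.
  rewrite max_labelE.
  have [|w wu Ew] := @eq_bigmax_cond _ (mem (below u)) (label u); last by exists w.
  by apply/card_gt0P; exists v.
by have := no w; rewrite Ew wu eqxx.
Qed.

Lemma max_label_gate u : gate u -> max_label u = index u gates.
Proof.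
by move=> gu; have /cards1P[v Ev] := gu; rewrite max_labelE Ev big_set1 label_gate // Ev inE.
Qed.

(* The halfspaces containing w are among those containing u and include the one
   of largest label, so going down across that one commutes with going down to w. *)
Lemma parent_below u w :
  w \in below u -> w != parent u ->
  [/\ max_label w = max_label u, parent w \in below (parent u),
      max_label (parent u) < max_label u &
      label u w = label (parent u) (parent w)].
Proof.
move=> wu nw; have [pu Lp] := parentP wu.
have [x [xw xp E1 E2]] := below_quadrangle e_median wu pu nw.
have le_up y z : y \in below u -> z \in below y -> label y z <= max_label u.
  move=> yu zy; apply: label_le_max => //; apply/negPn/negP => uh.
  have [yu' dy] := belowP e_median yu; have [yz _] := belowP e_median zy.
  have [yh _ rh] := below_half e_median zy.
  have e_sym : symmetric e by have [[]] := e_median.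
  rewrite e_sym in yu'; have [Eh _] := half_edge e_median yz yu' yh uh.
  have [_ _] := below_half e_median yu.
  by rewrite (mem_halfC e_median r yu') Eh rh.
have Mw : max_label w = max_label u.
  apply/eqP; rewrite eqn_leq; apply/andP; split.
    by rewrite max_labelE; apply/bigmax_leqP => z zw; apply: le_up zw.
  rewrite -Lp; have -> : label u (parent u) = label w x by rewrite !labelE E2.
  exact: leq_max_label.
have [pw Lw] := parentP xw.
have Ex : parent w = x.
  apply: (half_below_inj e_median pw xw); apply: label_inj => //.
  by rewrite Lw Mw -Lp !labelE E2.
rewrite Ex; split=> //; last by rewrite !labelE E1.
have lt_y y : y \in below (parent u) -> label (parent u) y < max_label u.
  move=> yp; rewrite ltn_neqAle (le_up _ _ pu yp) andbT -Lp; apply/eqP => E.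
  have [_ ph _] := below_half e_median pu; have [ph' _ _] := below_half e_median yp.
  by rewrite (label_inj yp pu E) (negPf ph) in ph'.
have [_ <-] := parentP xp; exact/lt_y/(parentP xp).1.
Qed.

(** Lets the program find the parent before any edge at [u] is labelled: by [parent_below] every
    other neighbour below has strictly larger [max_label]. *)
Lemma parent_argmin u p :
  p \in below u -> {in below u, forall w, max_label p <= max_label w} ->
  p = parent u.
Proof.
move=> pu min_p; apply/eqP/negPn/negP => np.
have [Mp _ lt_p _] := parent_below pu np.
by have := min_p _ (parentP pu).1; rewrite Mp leqNgt lt_p.
Qed.

(** Neighbours below other than the parent share the [max_label] of [u], and the parent has a
    smaller one; outside gates, a nonempty [below u] contains a non-parent, so the maximum is
    right. *)
Lemma max_label_argmax u a :
  ~~ gate u -> a \in below u ->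
  {in below u, forall w, max_label w <= max_label a} ->
  max_label a = max_label u.
Proof.
move=> ngu au max_a; have [pu _] := parentP au.
have [Ea|na] := eqVneq a (parent u); last by have [] := parent_below au na.
have [w wu nw] : exists2 w, w \in below u & w != a.
  have : 0 < #|below u :\ a| by move: ngu; rewrite /gate (cardsD1 a) au; lia.
  by case/card_gt0P => w; rewrite !inE => /andP[? ?]; exists w; rewrite ?inE.
have := max_a _ wu; rewrite Ea in nw *.
by have [-> _] := parent_below wu nw; lia.
Qed.

Hypothesis q_uniq : uniq q.

Lemma label_surj i : i < size gates -> exists u v, v \in below u /\ label u v = i.
Proof.
move=> lt_i; have [c0 _] : exists c0, c0 \in gates.
  by case: gates lt_i => // c ? _; exists c; rewrite inE eqxx.
pose c := nth c0 gates i; have cgs : c \in gates by rewrite mem_nth.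
have gc : gate c by move: cgs; rewrite mem_filter => /andP[].
have /cards1P[v Ev] := gc; have vc : v \in below c by rewrite Ev inE.
by exists c, v; rewrite label_gate // index_uniq // filter_uniq.
Qed.

End Labels.

(** * Breadth-first order *)

Section BreadthFirst.

Variables (T : finType) (e : rel T) (r : T) (adj : T -> seq T).
Hypothesis e_median : median_graph e.
Hypothesis adjP : forall v, uniq (adj v) /\ forall w, (w \in adj v) = e v w.

Local Notation l := (dist e r).
Local Notation below := (below e r).

Let e_sym : symmetric e. Proof. by have [[]] := e_median. Qed.
Let e_conn : forall u v, connect e u v. Proof. by have [[]] := e_median. Qed.

(** The queue after [k] visits. Dequeuing only advances a head pointer, so the list never shrinks
    and ends up as the visiting order. *)
Fixpoint bfs (k : nat) : seq T :=
  if k is k'.+1 then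
    bfs k' ++ [seq w <- adj (nth r (bfs k') k') | w \notin bfs k']
  else [:: r].

Lemma bfs_root k : r \in bfs k.
Proof. by elim: k => [|k IHk]; rewrite ?mem_head //= mem_cat IHk. Qed.

Lemma bfs_uniq k : uniq (bfs k).
Proof.
elim: k => [//|k IHk] /=; rewrite cat_uniq IHk filter_uniq ?andbT; last first.
  by have [] := adjP (nth r (bfs k) k).
by apply/hasPn => w; rewrite mem_filter => /andP[].
Qed.

Definition bfs_inv (k : nat) : Prop :=
  let s := bfs k in
  [/\ k <= size s, sorted (relpre l leq) s,
      k < size s -> {in s, forall v, l v <= (l (nth r s k)).+1}
    & forall u w, u \in take k s -> e u w -> w \in s].

(** Induction on the level: a neighbour of [w] one level lower is in the queue, and it stands before
    position [k] because levels are sorted or because the queue is exhausted. Its neighbours have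
    therefore been added. *)
Lemma bfs_complete k w :
  bfs_inv k -> k = size (bfs k) \/ l w <= l (nth r (bfs k) k) -> w \in bfs k.
Proof.
move=> [le_k srt near closed].
move: {-1}(l w) (erefl (l w)) => j; elim: j w => [|j IHj] w lw.
  by move=> _; rewrite -(dist_eq0 e_conn lw) bfs_root.
move=> hk; have [w' w'w lw'] : exists2 w', e w' w & l w' = j.
  rewrite (dist_sym e_sym e_conn) in lw; have [w' ww' dw'] := dist_step e_conn lw.
  by exists w'; rewrite 1?e_sym // (dist_sym e_sym e_conn).
have w's : w' \in bfs k by apply: IHj => //; lia.
apply: closed w'w; rewrite in_take //.
case: hk => [Ek|le_w]; first by rewrite [X in _ < X]Ek index_mem.
rewrite ltnNge; apply/negP => le_i.
have := sorted_relpre_nth r srt le_i; rewrite index_mem nth_index //.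
by move=> /(_ w's); lia.
Qed.

Lemma bfs_size_lt k : bfs_inv k -> k < #|T| -> k < size (bfs k).
Proof.
move=> inv lt_k; have [le_k _ _ _] := inv; rewrite ltn_neqAle le_k andbT.
apply/eqP => Ek; have all_s w : w \in bfs k by apply: bfs_complete => //; left.
have : #|T| <= size (bfs k).
  by rewrite -(card_uniqP (bfs_uniq k)); apply/subset_leq_card/subsetP.
lia.
Qed.

Lemma bfs_invP k : k <= #|T| -> bfs_inv k.
Proof.
elim: k => [|k IHk] lt_k.
  by split=> // _ v; rewrite inE => /eqP->; rewrite dist0.
have inv := IHk (ltnW lt_k); have lt_s := bfs_size_lt inv lt_k.
have [le_k srt near closed] := inv.
set u := nth r (bfs k) k in near *.
pose new := [seq w <- adj u | w \notin bfs k].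
(* A newly found vertex cannot be below [u], since [bfs_complete] says that all levels up to that of
   [u] are already queued. *)
have l_new w : w \in new -> l w = (l u).+1.
  rewrite mem_filter (adjP u).2 => /andP[wn uw].
  have := dist_adjacent e_median r uw; rewrite !(dist_sym e_sym e_conn _ r).
  case=> [lu|//]; case/negP: wn; apply: bfs_complete => //; right; rewrite -/u; lia.
have Eb : bfs k.+1 = bfs k ++ new by [].
have le_s : k.+1 <= size (bfs k.+1) by rewrite Eb size_cat; lia.
have all_le v : v \in bfs k.+1 -> l v <= (l u).+1.
  by rewrite Eb mem_cat => /orP[/near|/l_new->] //; apply.
have srt' : sorted (relpre l leq) (bfs k.+1).
  have tr : transitive (relpre l leq) by move=> x y z; apply: leq_trans.
  rewrite sorted_pairwise // Eb pairwise_cat -!sorted_pairwise // srt /=.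
  apply/andP; split.
    by apply/allrelP => x y xs /l_new /= ->; apply: near.
  rewrite sorted_pairwise //; apply/(pairwiseP u) => i j; rewrite !inE => lti ltj _ /=.
  by rewrite (l_new _ (mem_nth u lti)) (l_new _ (mem_nth u ltj)).
split=> //.
  move=> lt_s' v /all_le le_v; apply: leq_trans le_v _; rewrite ltnS.
  have := sorted_relpre_nth r srt' (leqnSn k) lt_s'.
  by rewrite {1}/bfs -/bfs nth_cat lt_s.
move=> x w; rewrite Eb takel_cat // (take_nth r) // mem_rcons inE => /orP[/eqP-> uw|xs xw].
  by rewrite mem_cat mem_filter (adjP _).2 uw andbT orbN.
by rewrite mem_cat (closed x).
Qed.

Definition bfs_order : seq T := bfs #|T|.

Lemma bfs_order_mem v : v \in bfs_order.
Proof.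
have inv := bfs_invP (leqnn _); apply: bfs_complete => //; left.
have [le_s _ _ _] := inv; apply/eqP; rewrite eqn_leq le_s /=.
by rewrite -(card_uniqP (bfs_uniq _)) max_card.
Qed.

Lemma size_bfs_order : size bfs_order = #|T|.
Proof.
rewrite -(card_uniqP (bfs_uniq _)); apply: eq_card => v.
by rewrite inE bfs_order_mem.
Qed.

Lemma bfs_order_sorted : sorted (relpre l leq) bfs_order.
Proof. by have [] := bfs_invP (leqnn #|T|). Qed.

Lemma bfs_prefix k : k <= #|T| -> bfs k = take (size (bfs k)) bfs_order.
Proof.
move=> le_k; rewrite /bfs_order -(subnKC le_k).
elim: (_ - _) => [|j IHj]; first by rewrite addn0 take_size.
by rewrite addnS /= takel_cat // [X in size X <= _]IHj size_take_min geq_minr.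
Qed.

Lemma bfs_lt_size k : k < #|T| -> k < size (bfs k).
Proof. by move=> lt_k; apply: bfs_size_lt => //; apply/bfs_invP/ltnW. Qed.

Lemma bfs_nth k i : k <= #|T| -> i < size (bfs k) -> nth r (bfs k) i = nth r bfs_order i.
Proof. by move=> le_k lt_i; rewrite (bfs_prefix le_k) nth_take. Qed.

Lemma mem_take_bfs k v :
  k <= #|T| -> v \in take k bfs_order -> v \in bfs k.
Proof.
move=> le_k; rewrite (bfs_prefix le_k); have [le_s _ _ _] := bfs_invP le_k.
by rewrite !in_take ?bfs_order_mem // => lt_v; apply: leq_trans le_s.
Qed.

(** Levels never decrease along the queue and adjacent vertices have different levels. Having been
    visited thus replaces a comparison of distances. *)
Lemma bfs_earlier_below k w :
  k < #|T| -> e (nth r bfs_order k) w ->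
  (w \in take k bfs_order) = (w \in below (nth r bfs_order k)).
Proof.
set u := nth r bfs_order k => lt_k uw.
rewrite in_take ?bfs_order_mem // inE uw /=.
have := dist_adjacent e_median r uw; rewrite !(dist_sym e_sym e_conn _ r) => luw.
have mono i j : i <= j -> j < #|T| -> l (nth r bfs_order i) <= l (nth r bfs_order j).
  by rewrite -size_bfs_order; apply/sorted_relpre_nth/bfs_order_sorted.
have lt_w : index w bfs_order < #|T| by rewrite -size_bfs_order index_mem bfs_order_mem.
apply/idP/idP => [lt_i|lt_l].
  by have := mono _ _ (ltnW lt_i) lt_k; rewrite nth_index ?bfs_order_mem // -/u; lia.
rewrite ltnNge; apply/negP => le_i.
by have := mono _ _ le_i lt_w; rewrite nth_index ?bfs_order_mem // -/u; lia.
Qed.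

Lemma card_edges : #|edges e| = \sum_u #|below u|.
Proof.
pose B := [set p : T * T | p.2 \in below p.1].
have -> : edges e = [set [set p.1; p.2] | p in B].
  apply/setP => x; apply/(edgesP r e_median)/imsetP => [[u [v [vu ->]]]|[[u v]]].
    by exists (u, v); rewrite // in_set.
  by rewrite in_set /= => vu ->; exists u, v.
rewrite card_in_imset => [|[u v] [a b]]; last first.
  rewrite ![_ \in B]in_set /= => vu ba E.
  by have [-> ->] := below_pair_inj e_median vu ba E.
rewrite -sum1_card (eq_bigr (fun u => \sum_(v in below u) 1)) => [|u _]; last by rewrite sum1_card.
rewrite pair_big_dep /=; by apply: eq_bigl => -[u v]; rewrite in_set.
Qed.

(** Every adjacent ordered pair goes down in exactly one of its two directions, and [card_edges]
    counts an edge at its upper end. *)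
Lemma sum_degrees : \sum_u size (adj u) = 2 * #|edges e|.
Proof.
rewrite mul2n -addnn {2}card_edges card_edges.
have -> : \sum_u #|below u| + \sum_u #|below u| =
    \sum_u \sum_v ((v \in below u) + (u \in below v)).
  have E : \sum_u #|below u| = \sum_u \sum_v (v \in below u : nat).
    by apply: eq_bigr => u _; rewrite -sum1_card big_mkcond; apply: eq_bigr => v _; case: ifP.
  rewrite {2}E exchange_big E -big_split; apply: eq_bigr => u _.
  by rewrite -big_split.
apply: eq_bigr => u _; rewrite -(card_uniqP (adjP u).1) -sum1_card big_mkcond.
apply: eq_bigr => v _; rewrite (adjP u).2 !inE (e_sym v) andbC [_ && e u v]andbC.
case uv : (e u v); rewrite ?andbF //=; have := dist_adjacent e_median r uv.
rewrite !(dist_sym e_sym e_conn _ r); lia.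
Qed.

(** Every vertex except the root is the upper end of some edge. *)
Lemma card_vertices_le : #|T| <= (#|edges e|).+1.
Proof.
rewrite card_edges (bigD1 r) //= below_root cards0 add0n (cardD1 r) inE add1n ltnS.
rewrite -sum1_card; apply: leq_trans (_ : \sum_(u | u != r) 1 <= _).
  by rewrite leq_eqVlt; apply/orP; left; apply/eqP/eq_bigl => u; rewrite !inE andbT.
apply: leq_sum => u nu; have [v vu] := below_exists e_median nu.
by apply/card_gt0P; exists v.
Qed.

End BreadthFirst.

(** * Running loop-free commands and loops *)

Section Machine.

Variable W : nat.

Fixpoint value (s : state) (x : expr) : nat :=
  match x with
  | Const k => k
  | Reg r => reg s r
  | Fetch a y => bank s a (value s y)
  | Bin o y z => binop_sem o (value s y) (value s z)
  end.

(** Equivalent to a nonzero value ([holdsE]), but comparisons appear as booleans ready for case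
    analysis. *)
Definition holds (s : state) (x : expr) : bool :=
  match x with
  | Bin Ltn y z => value s y < value s z
  | Bin Eqn y z => value s y == value s z
  | _ => value s x != 0
  end.

Lemma holdsE s x : holds s x = (value s x != 0).
Proof. by case: x => // -[] // y z /=; [case: ltnP | case: eqP]. Qed.

Definition fits (s : state) : Prop :=
  (forall r, reg s r < W) /\ (forall a i, bank s a i < W).

(* In a state that fits, only constants and sums can overflow. *)
Fixpoint no_overflow (s : state) (x : expr) : Prop :=
  match x with
  | Const k => k < W
  | Reg _ => True
  | Fetch _ y => no_overflow s y
  | Bin o y z =>
      [/\ no_overflow s y, no_overflow s z
        & if o is Add then value s y + value s z < W else True]
  end.

Hypothesis W_gt1 : 1 < W.

Lemma eval_value s x :
  fits s -> no_overflow s x ->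
  eval W s x = Some (value s x) /\ value s x < W.
Proof.
move=> [reg_lt bank_lt].
have wordE v : v < W -> word W v = Some v by rewrite /word => ->.
elim: x => [k|r|a y IHy|o y IHy z IHz] /=.
- by move=> lt_k; rewrite wordE.
- by rewrite wordE.
- by move=> /IHy[-> _] /=; rewrite wordE.
case=> /IHy[-> lt_y] /IHz[-> lt_z] /= lt_o.
suff lt_v : binop_sem o (value s y) (value s z) < W by rewrite wordE.
case: o lt_o => //= _; first exact: leq_ltn_trans (leq_subr _ _) lt_y.
- exact: leq_ltn_trans (leq_b1 _) W_gt1.
- exact: leq_ltn_trans (leq_b1 _) W_gt1.
Qed.

Lemma fits_set_reg s r v : fits s -> v < W -> fits (set_reg s r v).
Proof. by move=> [? ?] ?; split=> // i /=; rewrite /upd; case: eqP. Qed.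

Lemma fits_set_bank s a i v : fits s -> v < W -> fits (set_bank s a i v).
Proof. by move=> [? ?] ?; split=> // b j /=; rewrite /upd; do 2?case: eqP. Qed.

Definition run (c : cmd) (s : state) (T : nat) (Q : state -> Prop) : Prop :=
  exists s' t, [/\ exec W c s s' t, t <= T, fits s' & Q s'].

Fixpoint vc (c : cmd) (s : state) (Q : state -> Prop) : Prop :=
  match c with
  | Skip => Q s
  | Assign r x => no_overflow s x /\ Q (set_reg s r (value s x))
  | Store a x y =>
      [/\ no_overflow s x, no_overflow s y
        & Q (set_bank s a (value s x) (value s y))]
  | Seq c1 c2 => vc c1 s (fun s1 => vc c2 s1 Q)
  | If x c1 c2 =>
      no_overflow s x /\ if holds s x then vc c1 s Q else vc c2 s Q
  | While _ _ => False
  end.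

(** Charging both branches of an [If] gives an upper bound that does not depend on the state. *)
Fixpoint cost (c : cmd) : nat :=
  match c with
  | Skip => 1
  | Assign _ x => (expr_cost x).+1
  | Store _ x y => (expr_cost x + expr_cost y).+1
  | Seq c1 c2 => cost c1 + cost c2
  | If x c1 c2 => (expr_cost x + (cost c1 + cost c2)).+1
  | While x c => (expr_cost x + cost c).+1
  end.

Lemma run_vc c s (Q : state -> Prop) : fits s -> vc c s Q -> run c s (cost c) Q.
Proof.
elim: c s Q => [|r x|a x y|c1 IH1 c2 IH2|x c1 IH1 c2 IH2|//] s Q fs /=.
- by move=> Qs; exists s, 1; split=> //; constructor.
- move=> [/(eval_value fs)[Ex ltx] Qs].
  by exists (set_reg s r (value s x)), (expr_cost x).+1; split; [constructor| |apply: fits_set_reg|].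
- move=> [/(eval_value fs)[Ex ltx] /(eval_value fs)[Ey lty] Qs].
  exists (set_bank s a (value s x) (value s y)), (expr_cost x + expr_cost y).+1.
  by split; [constructor| |apply: fits_set_bank|].
- move=> /IH1 -/(_ fs)[s1 [t1 [ex1 le1 fs1 /IH2 -/(_ fs1)[s2 [t2 [ex2 le2 fs2 Qs2]]]]]].
  by exists s2, (t1 + t2); split=> //; [apply: ExecSeq ex1 ex2 | apply: leq_add].
- rewrite holdsE => -[/(eval_value fs)[Ex ltx] vcs].
  have [s' [t [ex le_t fs' Qs']]] : run (if value s x != 0 then c1 else c2) s (cost c1 + cost c2) Q.
    case: ifP vcs => _ => [/IH1|/IH2] -/(_ fs)[s' [t [ex le_t fs' Qs']]];
    by exists s', t; split=> //; lia.
  exists s', (expr_cost x + t).+1; split=> //; last by lia.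
  exact: ExecIf Ex ex.
Qed.

Lemma run_seq c1 c2 s T1 T2 (P Q : state -> Prop) :
  run c1 s T1 P -> (forall s1, fits s1 -> P s1 -> run c2 s1 T2 Q) ->
  run (Seq c1 c2) s (T1 + T2) Q.
Proof.
move=> [s1 [t1 [ex1 le1 fs1 Ps1]]] /(_ _ fs1 Ps1)[s2 [t2 [ex2 le2 fs2 Qs2]]].
by exists s2, (t1 + t2); split=> //; [apply: ExecSeq ex1 ex2 | apply: leq_add].
Qed.

(** The number [N] of rounds is known beforehand and replaces a termination measure; [f] varies with
    the round so that a visit can be charged by degree. *)
Lemma run_while x c (N : nat) (f : nat -> nat) (I : nat -> state -> Prop) s :
  (forall k s1, k < N -> fits s1 -> I k s1 ->
    [/\ no_overflow s1 x, holds s1 x & run c s1 (f k) (I k.+1)]) ->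
  (forall s1, I N s1 -> no_overflow s1 x /\ ~~ holds s1 x) ->
  fits s -> I 0 s ->
  run (While x c) s (\sum_(k < N) (f k + (expr_cost x).+1) + (expr_cost x).+1) (I N).
Proof.
move=> step stop fs Is.
suff loop j k s1 : k + j = N -> fits s1 -> I k s1 ->
    run (While x c) s1 (\sum_(k <= i < N) (f i + (expr_cost x).+1) + (expr_cost x).+1) (I N).
  by have := loop N 0 s (add0n N) fs Is; rewrite big_mkord.
elim: j k s1 => [|j IHj] k s1 Ek fs1 Is1.
  rewrite addn0 in Ek; subst k; have [ov] := stop _ Is1.
  rewrite holdsE negbK => /eqP x0.
  have [Ex _] := eval_value fs1 ov; rewrite x0 in Ex.
  by exists s1, (expr_cost x).+1; rewrite big_geq //; split=> //; constructor.
have lt_k : k < N by lia.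
have [ov x1 [s2 [t [ex le_t fs2 Is2]]]] := step _ _ lt_k fs1 Is1.
rewrite holdsE in x1; have [Ex _] := eval_value fs1 ov.
have [|s3 [t3 [ex3 le_t3 fs3 Is3]]] := IHj k.+1 s2 _ fs2 Is2; first by lia.
exists s3, (expr_cost x + t + t3).+1; split=> //; last by rewrite big_ltn //; lia.
exact: ExecWhileTrue Ex x1 ex ex3.
Qed.

Lemma run_weaken c s T T' (P Q : state -> Prop) :
  run c s T P -> T <= T' -> (forall s', P s' -> Q s') -> run c s T' Q.
Proof.
move=> [s' [t [ex le_t fs' Ps']]] le_T PQ.
by exists s', t; split=> //; [apply: leq_trans le_T | apply: PQ].
Qed.

End Machine.

(** * The program *)

(* rRow holds n times the value of rHead, the address of the matrix row of rU;
   rMin and rMax are the neighbours below rU of least and greatest bMax. *)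
Notation rN := 0 (only parsing).
Notation rCount := 1 (only parsing).
Notation rHead := 2 (only parsing).
Notation rTail := 3 (only parsing).
Notation rRow := 4 (only parsing).
Notation rU := 5 (only parsing).
Notation rJ := 6 (only parsing).
Notation rW := 7 (only parsing).
Notation rDeg := 8 (only parsing).
Notation rMin := 9 (only parsing).
Notation rMax := 10 (only parsing).
Notation rLab := 11 (only parsing).

(* bStatus is 0, 1 or 2 for a vertex unseen, queued or visited. *)
Notation bOff := 0 (only parsing).
Notation bAdj := 1 (only parsing).
Notation bOut := 2 (only parsing).
Notation bQueue := 3 (only parsing).
Notation bStatus := 4 (only parsing).
Notation bRow := 5 (only parsing).
Notation bMax := 6 (only parsing).
Notation bParent := 7 (only parsing).
Notation bMatrix := 8 (only parsing).

Definition incr (r : nat) : cmd := Assign r (Bin Add (Reg r) (Const 1)).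

Definition more_neighbours : expr :=
  Bin Ltn (Reg rJ) (Fetch bOff (Bin Add (Reg rU) (Const 1))).

Definition enqueue : cmd :=
  Seq (Store bQueue (Reg rTail) (Reg rW))
 (Seq (incr rTail)
      (Store bStatus (Reg rW) (Const 1))).

Definition update_extrema : cmd :=
  Seq (If (Bin Eqn (Reg rDeg) (Const 0))
        (Seq (Assign rMin (Reg rW)) (Assign rMax (Reg rW)))
        (Seq (If (Bin Ltn (Fetch bMax (Reg rW)) (Fetch bMax (Reg rMin)))
               (Assign rMin (Reg rW)) Skip)
             (If (Bin Ltn (Fetch bMax (Reg rMax)) (Fetch bMax (Reg rW)))
               (Assign rMax (Reg rW)) Skip)))
      (incr rDeg).

Definition scan : cmd :=
  Seq (Assign rW (Fetch bAdj (Reg rJ)))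
 (Seq (If (Bin Eqn (Fetch bStatus (Reg rW)) (Const 0)) enqueue
        (If (Bin Eqn (Fetch bStatus (Reg rW)) (Const 2)) update_extrema Skip))
      (incr rJ)).

(** A second pass over the list, because labelling needs the parent and the largest label found by
    the first. Look-ups here go from upper to lower end; the reversed entry serves the final
    copy. *)
Definition mark : cmd :=
  Seq (Assign rW (Fetch bAdj (Reg rJ)))
 (Seq (If (Bin Eqn (Fetch bStatus (Reg rW)) (Const 2))
        (Seq (If (Bin Eqn (Reg rW) (Reg rMin))
               (Assign rLab (Fetch bMax (Reg rU)))
               (Assign rLab
                  (Fetch bMatrix (Bin Add (Fetch bRow (Reg rMin))
                                          (Fetch bParent (Reg rW))))))
        (Seq (Store bMatrix (Bin Add (Fetch bRow (Reg rU)) (Reg rW)) (Reg rLab))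
             (Store bMatrix (Bin Add (Fetch bRow (Reg rW)) (Reg rU)) (Reg rLab))))
        Skip)
      (incr rJ)).

Definition enter : cmd :=
  Seq (Assign rU (Fetch bQueue (Reg rHead)))
 (Seq (Store bRow (Reg rU) (Reg rRow))
 (Seq (Assign rMin (Reg rU))
 (Seq (Assign rMax (Reg rU))
 (Seq (Assign rDeg (Const 0))
      (Assign rJ (Fetch bOff (Reg rU))))))).

Definition settle : cmd :=
  Seq (If (Bin Eqn (Reg rDeg) (Const 1))
        (Seq (Store bMax (Reg rU) (Reg rCount)) (incr rCount))
        (Store bMax (Reg rU) (Fetch bMax (Reg rMax))))
 (Seq (Store bParent (Reg rU) (Reg rMin))
      (Assign rJ (Fetch bOff (Reg rU)))).

Definition leave : cmd :=
  Seq (Store bStatus (Reg rU) (Const 2))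
 (Seq (incr rHead)
      (Assign rRow (Bin Add (Reg rRow) (Reg rN)))).

Definition visit : cmd :=
  Seq enter
 (Seq (While more_neighbours scan)
 (Seq settle
 (Seq (While more_neighbours mark)
      leave))).

(** Address 0 of [bQueue] initially holds 0, so the root, vertex 0, is queued by setting the
    tail. *)
Definition start : cmd :=
  Seq (Assign rTail (Const 1)) (Store bStatus (Const 0) (Const 1)).

Definition rewind : cmd := Seq (Assign rU (Const 0)) (Assign rJ (Const 0)).

(** Labels go through the matrix because writing at the slot of the reversed edge during a visit
    would require finding [u] in another list. *)
Definition copy : cmd :=
  Seq (Store bOut (Reg rJ)
        (Fetch bMatrix (Bin Add (Fetch bRow (Reg rU)) (Fetch bAdj (Reg rJ)))))
      (incr rJ).

Definition theta_classes_prog : cmd :=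
  Seq start
 (Seq (While (Bin Ltn (Reg rHead) (Reg rTail)) visit)
 (Seq rewind
      (While (Bin Ltn (Reg rU) (Reg rN))
        (Seq (While more_neighbours copy) (incr rU))))).

(** * Correctness and cost *)

Section Correctness.

Variables (n : nat) (e : rel 'I_n) (adj : 'I_n -> seq 'I_n) (W : nat) (r : 'I_n).
Hypothesis e_median : median_graph e.
Hypothesis adjP : adjacency_lists e adj.
Hypothesis r0 : r = 0 :> nat.
Local Notation m := #|edges e|.
Hypothesis W_ge : (n + m).+2 ^ 2 <= W.

Local Notation q := (bfs_order r adj).
Local Notation below := (below e r).
Local Notation gate := (gate e r).
Local Notation label := (label e r q).
Local Notation max_label := (max_label e r q).
Local Notation parent := (parent e r q).

Let e_sym : symmetric e. Proof. by have [[]] := e_median. Qed.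
Let n_gt0 : 0 < n. Proof. exact: leq_ltn_trans (ltn_ord r). Qed.

(** The bound on [n * n] is the one that needs the square: it covers matrix addresses and the row
    register, which ends at [n * n]. *)
Lemma W_bounds : [/\ 3 < W, n.+3 < W, (2 * m).+2 < W & n * n < W].
Proof.
move: W_ge; rewrite -mulnn; move: m n_gt0 => m'; split; nia.
Qed.

Let W_gt1 : 1 < W. Proof. by have [] := W_bounds; lia. Qed.

Lemma q_uniq : uniq q. Proof. exact: (bfs_uniq r adjP). Qed.
Lemma q_mem v : v \in q. Proof. exact: (bfs_order_mem r e_median adjP). Qed.
Lemma q_size : size q = n.
Proof. by rewrite (size_bfs_order r e_median adjP) card_ord. Qed.
Definition pos (v : 'I_n) : nat := index v q.

Lemma pos_lt v : pos v < n.
Proof. by have := q_mem v; rewrite -index_mem q_size. Qed.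

Lemma nth_pos v : nth r q (pos v) = v.
Proof. by rewrite nth_index ?q_mem. Qed.

Lemma q_sorted : sorted (relpre (dist e r) leq) q.
Proof. exact: (bfs_order_sorted r e_median adjP). Qed.

Definition off (i : nat) : nat := sumn (take i (shape (lists adj))).

Lemma size_lists : size (lists adj) = n.
Proof. by rewrite size_map size_enum_ord. Qed.

Lemma nth_lists (v : 'I_n) : nth [::] (lists adj) v = map val (adj v).
Proof. by rewrite (nth_map v) ?size_enum_ord // nth_ord_enum. Qed.

Lemma nth_shape (v : 'I_n) : nth 0 (shape (lists adj)) v = size (adj v).
Proof. by rewrite (nth_map [::]) ?size_lists // nth_lists size_map. Qed.

Lemma offS (v : 'I_n) : off v.+1 = off v + size (adj v).
Proof.
have lt_v : v < size (shape (lists adj)) by rewrite size_map size_lists.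
by rewrite /off (take_nth 0 lt_v) sumn_rcons nth_shape.
Qed.

Lemma off_n : off n = 2 * m.
Proof.
have sz : size (shape (lists adj)) = n by rewrite size_map size_lists.
rewrite /off take_oversize ?sz // -(sum_degrees r e_median adjP) sumnE !big_map.
by rewrite -enumT big_enum /=; apply: eq_bigr => v _; rewrite size_map.
Qed.

Lemma leq_off i j : i <= j -> off i <= off j.
Proof. by move=> le_ij; rewrite /off -(subnKC le_ij) takeD sumn_cat leq_addr. Qed.

Lemma off_le i : i <= n -> off i <= 2 * m.
Proof. by rewrite -off_n; apply: leq_off. Qed.

Definition reads_input (s : state) : Prop :=
  [/\ reg s rN = n, forall i, i <= n -> bank s bOff i = off i
    & forall (v : 'I_n) i, i < size (adj v) ->
        bank s bAdj (off v + i) = nth r (adj v) i].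

Lemma input_reads : reads_input (input adj).
Proof.
split=> //= [i le_i|v i lt_i]; first by rewrite nth_mkseq.
rewrite nth_flatten (_ : off v + i = flatten_index (shape (lists adj)) v i) //.
rewrite flatten_indexKl ?flatten_indexKr ?nth_shape // nth_lists.
by rewrite (nth_map r).
Qed.

Lemma input_fits : fits W (input adj).
Proof.
have [? ? ? ?] := W_bounds; split=> [i|[|[|a]] i] /=; first by case: eqP; lia.
- case: (ltnP i n.+1) => lt_i; last by rewrite nth_default ?size_mkseq //; lia.
  by rewrite nth_mkseq //; have := off_le lt_i; rewrite /off; lia.
- case: (ltnP i (size (flatten (lists adj)))) => lt_i; last by rewrite nth_default; lia.
  have /flatten_mapP[v _ /mapP[w _ ->]] := mem_nth 0 lt_i.
  by have /= := ltn_ord w; lia.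
- by lia.
Qed.

(* The entries of the n x n matrix are written before they are read, so the
   matrix needs no initialisation. Its rows are in the order of the queue, which
   avoids a multiplication. *)
Definition row (v : 'I_n) : nat := pos v * n.
Definition addr (u v : 'I_n) : nat := row u + v.

Lemma addr_lt u v : addr u v < W.
Proof.
have [_ _ _ lt_W] := W_bounds; rewrite /addr /row.
have := ltn_ord v; have := leq_mul (pos_lt u) (leqnn n); rewrite mulSn; lia.
Qed.

Lemma addr_inj u v u' v' : addr u v = addr u' v' -> u = u' /\ v = v'.
Proof.
rewrite /addr /row => E; have Ep : pos u = pos u'.
  by have := divnMDl (pos u) v n_gt0; rewrite E divnMDl // !(divn_small (ltn_ord _)) !addn0.
split; first by rewrite -(nth_pos u) Ep nth_pos.
by apply: val_inj; move: E; rewrite Ep => /addnI.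
Qed.

(** The zeros of [bMax] outside the visited part are recorded because the root, with no neighbour
    below, copies its own entry. *)
Definition tables (k : nat) (s : state) : Prop :=
  (forall v : 'I_n, bank s bMax v = if v \in take k q then max_label v else 0) /\
  {in take k q, forall v : 'I_n, bank s bRow v = row v /\ bank s bParent v = parent v}.

Definition edge_label (v w : 'I_n) : nat :=
  if w \in below v then label v w else label w v.

Definition matrix (k : nat) (s : state) : Prop :=
  {in take k q &, forall v w : 'I_n, e v w ->
    bank s bMatrix (addr v w) = edge_label v w}.

Definition queue (k : nat) (qs : seq 'I_n) (s : state) : Prop :=
  [/\ reg s rTail = size qs,
      forall i, i < size qs -> bank s bQueue i = nth r qs i
    & forall v : 'I_n, bank s bStatus v = if v \in take k q then 2 else v \in qs].

Definition counters (k : nat) (s : state) : Prop :=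
  [/\ reg s rCount = size (filter gate (take k q)), reg s rHead = k
    & reg s rRow = k * n].

Definition visited (k : nat) (s : state) : Prop :=
  [/\ reads_input s, tables k s, matrix k s, queue k (bfs r adj k) s
    & counters k s].

Lemma ord_eqE (v w : 'I_n) : (v == w :> nat) = (v == w).
Proof. by []. Qed.

Lemma slot_bound (v : 'I_n) j : j < size (adj v) -> off v + j + 1 <= 2 * m.
Proof. by move=> lt_j; have := off_le (ltn_ord v); rewrite offS; lia. Qed.

Lemma edge_labelC v w : e v w -> edge_label v w = edge_label w v.
Proof.
move=> vw; rewrite /edge_label.
have [vb|wb] := edge_orient r e_median vw.
  rewrite vb ifN //; apply/negP => /(belowP e_median)[_].
  by have [_] := belowP e_median vb; lia.
rewrite wb ifN //; apply/negP => /(belowP e_median)[_].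
by have [_] := belowP e_median wb; lia.
Qed.

(** * One visit: entering, scanning, settling, marking, leaving *)

Section Visit.

Variables (k : nat) (u : 'I_n).
Hypotheses (lt_k : k < n) (u_k : nth r q k = u).

Lemma lt_k_card : k < #|'I_n|. Proof. by rewrite card_ord. Qed.

Lemma current_fresh : u \notin take k q.
Proof. by rewrite -u_k in_take ?q_mem // index_uniq ?q_size ?ltnn // q_uniq. Qed.

Lemma take_next : take k.+1 q = rcons (take k q) u.
Proof. by rewrite (take_nth r) ?q_size // u_k. Qed.

Lemma done_below w : e u w -> (w \in take k q) = (w \in below u).
Proof. by rewrite -u_k; apply: (bfs_earlier_below e_median adjP lt_k_card). Qed.

Lemma row_current : row u = k * n.
Proof. by rewrite /row /pos -u_k index_uniq ?q_size // q_uniq. Qed.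

Definition done_neighbours (j : nat) : seq 'I_n :=
  [seq w <- take j (adj u) | w \in take k q].

Definition extrema (j : nat) (s : state) : Prop :=
  reg s rDeg = size (done_neighbours j) /\
  exists p a : 'I_n,
    [/\ reg s rMin = p, reg s rMax = a
      & (done_neighbours j = [::] -> p = u /\ a = u) /\
        forall w, w \in done_neighbours j ->
          [/\ p \in done_neighbours j, a \in done_neighbours j
            & max_label p <= max_label w <= max_label a]].

Definition at_neighbour (j : nat) (s : state) : Prop :=
  [/\ bank s bRow u = row u, reg s rU = u & reg s rJ = off u + j].

Definition queued (j : nat) : seq 'I_n :=
  bfs r adj k ++ [seq w <- take j (adj u) | w \notin bfs r adj k].

Definition scanned (j : nat) (s : state) : Prop :=
  [/\ reads_input s, tables k s, matrix k s & counters k s] /\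
  [/\ queue k (queued j) s, at_neighbour j s & extrema j s].

Lemma current_queued : k < size (bfs r adj k).
Proof. exact: (bfs_lt_size r e_median adjP lt_k_card). Qed.

Lemma run_enter s :
  fits W s -> visited k s -> run W enter s (cost enter) (scanned 0).
Proof.
move=> fs [[n_s off_s adj_s] [max_s rp_s] mat_s [tail_s q_s st_s] [cnt_s hd_s row_s]].
have [? ? ? ?] := W_bounds.
have Eu : bank s bQueue k = u.
  by rewrite q_s ?current_queued // (bfs_nth (ltnW lt_k_card)) ?u_k ?current_queued.
apply: run_vc => //=; rewrite /upd /= hd_s Eu.
split=> //; split=> //; split=> //; split=> //; split; first by lia.
split=> //; split; first split=> //.
- split=> // v vd /=; rewrite /upd /= ifN; first exact: rp_s.
  by apply: contraNneq current_fresh => /val_inj <-.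
- split.
  + by rewrite /queued take0 /= cats0; split.
  + by split=> //=; rewrite /upd /= ?eqxx ?row_s ?row_current // addn0 off_s // ltnW.
  + by split; rewrite /done_neighbours take0 //=; exists u, u.
Qed.

Lemma mem_queued j :
  j < size (adj u) -> nth r (adj u) j \in queued j = (nth r (adj u) j \in bfs r adj k).
Proof.
move=> lt_j; rewrite mem_cat mem_filter in_take ?mem_nth // index_uniq ?ltnn ?(adjP u).1 //.
by rewrite andbF orbF.
Qed.

Lemma queuedS j (w := nth r (adj u) j) :
  j < size (adj u) ->
  queued j.+1 = if w \in queued j then queued j else rcons (queued j) w.
Proof.
move=> lt_j; rewrite mem_queued // /queued (take_nth r) // filter_rcons.
by case: (_ \in bfs _ _ _); rewrite /= ?rcons_cat.
Qed.

Lemma queued_uniq j : uniq (queued j).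
Proof.
rewrite cat_uniq (bfs_uniq r adjP) filter_uniq ?take_uniq ?(adjP u).1 // andbT.
by apply/hasPn => w; rewrite mem_filter => /andP[].
Qed.

Lemma size_queued_le j : size (queued j) <= n.
Proof. by rewrite -(card_uniqP (queued_uniq j)) -[X in _ <= X](card_ord n) max_card. Qed.

Lemma done_neighboursS j (w := nth r (adj u) j) :
  j < size (adj u) ->
  done_neighbours j.+1 =
    if w \in take k q then rcons (done_neighbours j) w else done_neighbours j.
Proof. by move=> lt_j; rewrite /done_neighbours (take_nth r) // filter_rcons. Qed.

Lemma done_neighbours_done j w : w \in done_neighbours j -> w \in take k q.
Proof. by rewrite mem_filter => /andP[]. Qed.

Lemma size_done_neighbours j : size (done_neighbours j) <= j.
Proof. by rewrite size_filter (leq_trans (count_size _ _)) // size_take_min geq_minl. Qed.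

Lemma run_scan j s :
  j < size (adj u) -> fits W s -> scanned j s ->
  run W scan s (cost scan) (scanned j.+1).
Proof.
move=> lt_j fs [[[n_s off_s adj_s] [max_s rp_s] mat_s [cnt_s hd_s row_s]]
  [[tail_s q_s st_s] [rowu_s u_s j_s] [deg_s [p [a [p_s a_s [ext0 ext]]]]]]].
have [? ? ? ?] := W_bounds.
have Sq := queuedS lt_j; have Sd := done_neighboursS lt_j.
have le_q := size_queued_le j; have le_d := size_done_neighbours j.
have le_s := slot_bound lt_j.
have Ew := adj_s u j lt_j.
move: (nth r (adj u) j) Ew Sq Sd => w Ew Sq Sd.
have okj : [/\ True, 1 < W & off u + j + 1 < W] by split=> //; lia.
have okd : [/\ True, 1 < W & size (done_neighbours j) + 1 < W] by split=> //; lia.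
have okq : [/\ True, 1 < W & size (queued j) + 1 < W] by split=> //; lia.
have Ejump : off u + j + 1 = off u + j.+1 by rewrite addn1 addnS.
apply: run_vc => //=; rewrite /upd /= j_s Ew st_s.
split=> //; split; first by split=> //; lia.
case: (boolP (w \in take k q)) Sd => wd Sd.
  have wq : w \in queued j.
    by rewrite mem_cat (mem_take_bfs e_median adjP (ltnW lt_k_card)).
  rewrite wq in Sq; rewrite /=; split; first by split=> //; lia.
  have inv s1 : reads_input s1 /\ tables k s1 -> matrix k s1 ->
    counters k s1 -> queue k (queued j) s1 ->
    at_neighbour j.+1 s1 -> extrema j.+1 s1 -> scanned j.+1 s1.
    by move=> [? ?] *; rewrite /scanned Sq.
  have new_extrema (p1 a1 : 'I_n) s1 :
      p1 \in rcons (done_neighbours j) w -> a1 \in rcons (done_neighbours j) w ->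
      (forall x, x \in rcons (done_neighbours j) w ->
        max_label p1 <= max_label x <= max_label a1) ->
      reg s1 rDeg = size (done_neighbours j) + 1 ->
      reg s1 rMin = p1 -> reg s1 rMax = a1 ->
      extrema j.+1 s1.
    move=> p1D a1D le_pa; rewrite /extrema Sd => -> -> ->.
    split; first by rewrite size_rcons addn1.
    exists p1, a1; split=> //; split; first by case: (done_neighbours j).
    by move=> x xD; split=> //; apply: le_pa.
  have maxw : bank s bMax w = max_label w by rewrite max_s wd.
  split; first by split=> //; lia.
  rewrite deg_s p_s a_s.
  have [/size0nil D0|Dn0] := eqVneq (size (done_neighbours j)) 0; rewrite /=.
    do 2!split=> //; split; first by split=> //; lia.
    split; first by split=> //; lia.
    apply: inv => //; apply: (new_extrema w w) => //; rewrite ?D0 ?mem_head //.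
    by move=> x; rewrite inE => /eqP->; rewrite leqnn.
  have [pD aD] : p \in done_neighbours j /\ a \in done_neighbours j.
    case E : (done_neighbours j) Dn0 => [//|z D] _; rewrite -E.
    by have [|] := ext z; rewrite // E mem_head.
  have maxD x : x \in done_neighbours j -> bank s bMax x = max_label x.
    by move=> /done_neighbours_done xd; have := max_s x; rewrite xd.
  have leD x : x \in done_neighbours j -> max_label p <= max_label x <= max_label a.
    by case/ext.
  split; first by split.
  rewrite maxw (maxD p pD) (maxD a aD).
  have wR : w \in rcons (done_neighbours j) w by rewrite mem_rcons mem_head.
  have subR x : x \in done_neighbours j -> x \in rcons (done_neighbours j) w.
    by move=> xD; rewrite mem_rcons inE xD orbT.
  have leR x : x \in rcons (done_neighbours j) w ->
      x = w \/ max_label p <= max_label x <= max_label a.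
    by rewrite mem_rcons inE => /predU1P[->|/leD]; [left | right].
  have /andP[pp pa] := leD p pD.
  case: (ltnP (max_label w) (max_label p)) => le1; split=> //.
    (* A strictly new minimum is never also a strictly new maximum, as the old minimum is at most
       the old maximum. *)
    split=> //; case: (ltnP (max_label a) (max_label w)) => le2.
      by have := ltn_trans le2 (leq_trans le1 pa); rewrite ltnn.
    do 2!split=> //; apply: inv => //; apply: (new_extrema w a) => //; first exact: subR.
    by move=> x /leR[->|/andP[le_px ->]]; rewrite ?leqnn ?le2 // (leq_trans (ltnW le1)).
  case: (ltnP (max_label a) (max_label w)) => le2.
    do 3!split=> //; apply: inv => //; apply: (new_extrema p w) => //; first exact: subR.
    by move=> x /leR[->|/andP[-> le_xa]]; rewrite ?leqnn ?le1 // (leq_trans le_xa (ltnW le2)).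
  do 2!split=> //; apply: inv => //; apply: (new_extrema p a) => //; [exact: subR | exact: subR |].
  by move=> x /leR[->|//]; rewrite le1 le2.
have ext' s1 : reg s1 rDeg = reg s rDeg -> reg s1 rMin = reg s rMin ->
    reg s1 rMax = reg s rMax -> extrema j.+1 s1.
  by rewrite /extrema Sd => -> -> ->; split=> //; exists p, a.
case: (boolP (w \in queued j)) Sq => wq Sq /=.
  split; first by split=> //; lia.
  split; first exact: okj.
  split; first by split.
  by split; [rewrite Sq | split | apply: ext'].
rewrite tail_s; split=> //; split; first exact: okq.
split=> //; split; first exact: okj.
split; first by split.
split; [| by split | exact: ext'].
rewrite Sq; split=> [|i|v] /=; rewrite /upd /= ?size_rcons ?addn1 //.
  rewrite ltnS leq_eqVlt nth_rcons => /predU1P[->|lt_i]; first by rewrite eqxx ltnn.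
  by rewrite lt_i (ltn_eqF lt_i) q_s.
rewrite ord_eqE st_s mem_rcons inE; case: eqVneq => [->|//].
by rewrite (negPf wd).
Qed.

Definition marked (j : nat) (s : state) : Prop :=
  [/\ reads_input s, tables k.+1 s, matrix k s & queue k (bfs r adj k.+1) s] /\
  [/\ [/\ reg s rCount = size (filter gate (take k.+1 q)), reg s rHead = k
        & reg s rRow = k * n],
      at_neighbour j s, reg s rMin = parent u
    & forall w, w \in done_neighbours j ->
        bank s bMatrix (addr u w) = edge_label u w /\
        bank s bMatrix (addr w u) = edge_label u w].

Lemma mem_done_neighbours w : (w \in done_neighbours (size (adj u))) = (w \in below u).
Proof.
rewrite mem_filter take_size (adjP u).2; have [uw|] := boolP (e u w).
  by rewrite andbT done_below.
by rewrite andbF => /negP nuw; apply/esym/negP => /(belowP e_median)[].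
Qed.

Lemma size_below : size (done_neighbours (size (adj u))) = #|below u|.
Proof.
rewrite -(eq_card mem_done_neighbours); apply/esym/card_uniqP.
by rewrite filter_uniq // take_size (adjP u).1.
Qed.

Lemma queued_all : queued (size (adj u)) = bfs r adj k.+1.
Proof.
by rewrite /queued take_size /= (bfs_nth (ltnW lt_k_card)) ?u_k // current_queued.
Qed.

Lemma index_current : gate u -> index u (gates e r q) = size (filter gate (take k q)).
Proof.
move=> gu; rewrite /gates -{1}(cat_take_drop k q) (drop_nth r) ?q_size // u_k.
rewrite filter_cat /= gu index_cat mem_filter gu (negPf current_fresh) /=.
by rewrite eqxx addn0.
Qed.

Lemma mem_take_next v : (v \in take k.+1 q) = (v == u) || (v \in take k q).
Proof. by rewrite take_next mem_rcons inE. Qed.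

Lemma run_settle s :
  fits W s -> scanned (size (adj u)) s -> run W settle s (cost settle) (marked 0).
Proof.
move=> fs [[[n_s off_s adj_s] [max_s rp_s] mat_s [cnt_s hd_s row_s]]
  [que_s [rowu_s u_s j_s] [deg_s [p [a [p_s a_s [ext0 ext]]]]]]].
rewrite queued_all in que_s; rewrite size_below in deg_s.
have [? ? ? ?] := W_bounds.
have no_below : #|below u| = 0 -> p = u /\ a = u.
  by rewrite -size_below => /size0nil.
have some_below v : v \in below u -> [/\ p \in below u, a \in below u,
    {in below u, forall w, max_label p <= max_label w}
  & {in below u, forall w, max_label w <= max_label a}].
  rewrite -mem_done_neighbours => /ext[]; rewrite !mem_done_neighbours => pu au _.
  by split=> // w; rewrite -mem_done_neighbours => /ext[_ _ /andP[]].
have below_cases : #|below u| = 0 \/ exists v, v \in below u.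
  by case: (posnP #|below u|) => [|/card_gt0P]; [left | right].
have Ep : p = parent u.
  have [c0|[v vu]] := below_cases.
    have [-> _] := no_below c0; rewrite parentE; case: pickP => //= x /andP[xu].
    by rewrite (cardD1 x) xu in c0.
  have [pu _ min_p _] := some_below v vu.
  exact: (parent_argmin e_median q_mem q_sorted pu min_p).
have uq : u \notin take k q := current_fresh.
have Ea : ~~ gate u -> bank s bMax a = max_label u.
  move=> ngu; have [c0|[v vu]] := below_cases.
    have [_ ->] := no_below c0; rewrite max_s (negPf uq) max_labelE big1 // => x xu.
    by rewrite (cardD1 x) xu in c0.
  have [_ au _ max_a] := some_below v vu.
  have [au' _] := belowP e_median au; rewrite max_s done_below // au.
  exact: (max_label_argmax e_median q_mem q_sorted ngu au max_a).
(* The counter holds the number of gates visited before [u], which is the index of [u] among all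
   gates and so the label of its only edge down. *)
have Ec : gate u -> reg s rCount = max_label u.
  move=> gu; rewrite cnt_s -index_current //.
  by rewrite (max_label_gate q e_median gu).
have Ecnt : size (filter gate (take k.+1 q)) = reg s rCount + gate u.
  by rewrite take_next filter_rcons cnt_s; case: (gate u); rewrite ?size_rcons ?addn1 ?addn0.
have cnt_le : reg s rCount <= n.
  by rewrite cnt_s size_filter (leq_trans (count_size _ _)) // size_take_min q_size geq_minr.
have tabs s1 :
    (forall v : 'I_n, bank s1 bMax v = if v == u then max_label u else bank s bMax v) ->
    (forall v : 'I_n, bank s1 bRow v = bank s bRow v) ->
    (forall v : 'I_n,
      bank s1 bParent v = if v == u then parent u : nat else bank s bParent v) ->
    tables k.+1 s1.
  move=> max1 row1 par1; split=> [v|v]; rewrite mem_take_next.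
    by rewrite max1 max_s; case: eqVneq => [->|].
  by rewrite row1 par1; case: eqVneq => [->|_ /rp_s].
apply: run_vc => //=; rewrite /upd /= u_s deg_s.
split; first by split=> //; lia.
have Gu : (#|below u| == 1) = gate u by [].
rewrite Gu; case: (boolP (gate u)) => gu.
  split=> //; split; first by split=> //; lia.
  split=> //; split=> //; split.
    split=> //; apply: tabs => v //=; rewrite /upd /= ord_eqE; case: eqVneq => //= _.
      exact: Ec.
    by rewrite p_s Ep.
  split; [by split; rewrite // Ecnt gu | | by rewrite -Ep |].
    by split=> //=; rewrite /upd /= off_s ?addn0 // ltnW.
  by move=> w; rewrite /done_neighbours take0.
split=> //; split=> //; split=> //; split.
  split=> //; apply: tabs => v //=; rewrite /upd /= ord_eqE; case: eqVneq => //= _.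
    by rewrite a_s Ea.
  by rewrite p_s Ep.
split; [by split; rewrite // Ecnt (negPf gu) addn0 | | by rewrite -Ep |].
  by split=> //=; rewrite /upd /= off_s ?addn0 // ltnW.
by move=> w; rewrite /done_neighbours take0.
Qed.

(** Ensures that the edge from [parent u] to [parent w] has both ends visited, so that its matrix
    entry has been written when it is read. *)
Lemma below_done v w : v \in take k q -> w \in below v -> w \in take k q.
Proof.
rewrite in_take ?q_mem // -/(pos v) => lt_v wv; have [vw _] := belowP e_median wv.
have lt_n : pos v < #|'I_n| by rewrite card_ord pos_lt.
have := bfs_earlier_below (r := r) e_median adjP lt_n (w := w); rewrite (nth_pos v) => /(_ vw).
by rewrite wv !in_take ?q_mem // => lt_w; apply: ltn_trans lt_v.
Qed.

Lemma run_mark j s :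
  j < size (adj u) -> fits W s -> marked j s ->
  run W mark s (cost mark) (marked j.+1).
Proof.
move=> lt_j fs [[[n_s off_s adj_s] [max_s rp_s] mat_s [tail_s q_s st_s]]
  [[cnt_s hd_s row_s] [rowu_s u_s j_s] p_s new_s]].
have [? ? ? ?] := W_bounds.
have Sd := done_neighboursS lt_j; have le_s := slot_bound lt_j.
have Ew := adj_s u j lt_j; have uw : e u (nth r (adj u) j) by rewrite -(adjP u).2 mem_nth.
move: (nth r (adj u) j) uw Ew Sd => w uw Ew Sd.
have okj : [/\ True, 1 < W & off u + j + 1 < W] by split=> //; lia.
have Ejump : off u + j + 1 = off u + j.+1 by rewrite addn1 addnS.
have uu : u \in take k.+1 q by rewrite mem_take_next eqxx.
apply: run_vc => //=; rewrite /upd /= j_s Ew st_s u_s p_s ord_eqE.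
split=> //; split; first by split=> //; lia.
case: (boolP (w \in take k q)) Sd => wd Sd /=; last first.
  have -> : ((w \in bfs r adj k.+1) == 2 :> nat) = false by case: (_ \in _).
  split; first exact: okj.
  by split; split=> //; rewrite Sd.
have wu : w \in below u by rewrite -done_below.
have wd' : w \in take k.+1 q by rewrite mem_take_next wd orbT.
have [rw pw] := rp_s w wd'; have [ru pu] := rp_s u uu.
have nuw : u != w by apply: contraTneq wd => <-; apply: current_fresh.
have [pb Lp] := parentP q wu.
have pd : parent u \in take k q by rewrite done_below //; have [] := belowP e_median pb.
have rp : bank s bRow (parent u) = row (parent u).
  by have [] := rp_s (parent u); rewrite // mem_take_next pd orbT.
have aW (v v' : 'I_n) : bank s bRow v = row v -> bank s bRow v + v' < W.
  by move=> ->; apply: addr_lt.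
(* The two new writes have [u] as a coordinate, and [u] is not yet visited, so they miss all entries
   of edges between visited vertices. *)
have fin s1 : reads_input s1 -> tables k.+1 s1 -> queue k (bfs r adj k.+1) s1 ->
    [/\ reg s1 rCount = reg s rCount, reg s1 rHead = reg s rHead, reg s1 rRow = reg s rRow
      & reg s1 rMin = reg s rMin] -> at_neighbour j.+1 s1 ->
    bank s1 bMatrix =1
      upd (upd (bank s bMatrix) (addr u w) (edge_label u w))
        (addr w u) (edge_label u w) ->
    marked j.+1 s1.
  move=> reads1 tabs1 que1 [cnt1 hd1 row1 min1] at1 mat1.
  split; split=> //; rewrite ?cnt1 ?hd1 ?row1 ?min1 //.
    move=> x y xd yd xy; rewrite mat1 /upd !ifN ?mat_s //.
      by apply/eqP => /addr_inj[E _]; have := current_fresh; rewrite -E xd.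
    by apply/eqP => /addr_inj[_ E]; have := current_fresh; rewrite -E yd.
  move=> x; rewrite Sd mem_rcons inE !mat1 /upd => /predU1P[->|xd].
    by rewrite !eqxx; case: eqP => // ->.
  have [E1 E2] := new_s x xd; have {}xd := done_neighbours_done xd.
  have neq1 : addr x u == addr u w = false.
    by apply/eqP => /addr_inj[E _]; move: current_fresh; rewrite -E xd.
  rewrite neq1; split; last by case: eqP => // /addr_inj[->].
  case: eqP => [/addr_inj[E _]|_]; first by rewrite E eqxx in nuw.
  by case: eqP => // /addr_inj[_ ->].
have Eu : bank s bMax u = max_label u by rewrite max_s uu.
have El : edge_label u w = label u w by rewrite /edge_label wu.
split; first by [].
case: (eqVneq w (parent u)) => [Ewp|nwp].
  have El' : edge_label u w = max_label u by rewrite El Ewp Lp.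
  split=> //; rewrite Eu ru rw; split=> //; first by split=> //; apply: addr_lt.
  split=> //; first by split=> //; apply: addr_lt.
  by split; [exact: okj | apply: fin => // x; rewrite El'].
(* The opposite side of the square [u], [w], [parent w], [parent u] carries the label of [uw]. *)
have [_ ppb _ Lw] := parent_below e_median q_mem q_sorted wu nwp.
have ppd := below_done pd ppb.
have Elab : bank s bMatrix (addr (parent u) (parent w)) = edge_label u w.
  have [epp _] := belowP e_median ppb.
  by rewrite mat_s // El Lw /edge_label ppb.
rewrite rp pw ru rw -/(addr (parent u) (parent w)) Elab.
split; first by split=> //; apply: addr_lt.
split=> //; first by split=> //; apply: addr_lt.
split=> //; first by split=> //; apply: addr_lt.
by split; [exact: okj | apply: fin].
Qed.

Lemma run_leave s :
  fits W s -> marked (size (adj u)) s -> run W leave s (cost leave) (visited k.+1).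
Proof.
move=> fs [[[n_s off_s adj_s] tab_s mat_s [tail_s q_s st_s]]
  [[cnt_s hd_s row_s] [rowu_s u_s j_s] p_s new_s]].
have [? ? ? ?] := W_bounds.
apply: run_vc => //=; rewrite /upd /= u_s hd_s row_s n_s.
split=> //; first by lia.
split; first by split=> //; lia.
split; first by split=> //; have := leq_mul lt_k (leqnn n); rewrite mulSn; lia.
split=> //.
- move=> v w vd wd vw; have vw' := vw; rewrite e_sym in vw'.
  rewrite mem_take_next in vd; rewrite mem_take_next in wd.
  case/predU1P: vd wd vw vw' => [-> | vd] /predU1P[-> | wd] vw vw' /=.
  + by have [[_ _ irr _] _] := e_median; rewrite irr in vw.
  + by have [] := new_s w; rewrite ?mem_done_neighbours -?done_below.
  + by rewrite edge_labelC //; have [] := new_s v; rewrite ?mem_done_neighbours -?done_below.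
  + exact: mat_s.
- split=> // v /=; rewrite /upd /= ord_eqE mem_take_next; case: eqVneq => //=.
- by split=> //=; rewrite /upd /= ?addn1 // mulSn addnC.
Qed.

End Visit.

Lemma more_neighboursP (v : 'I_n) j s :
  reads_input s -> reg s rU = v -> reg s rJ = off v + j ->
  no_overflow W s more_neighbours /\ holds s more_neighbours = (j < size (adj v)).
Proof.
move=> [_ off_s _] v_s j_s; have [? ? ? ?] := W_bounds; have lt_v := ltn_ord v.
rewrite /= v_s j_s addn1 off_s // offS ltn_add2l; split=> //.
by split=> //; split=> //; lia.
Qed.

(** The 7 is the cost 6 of evaluating the loop test plus one step for the loop; it is paid once more
    on exit. *)
Lemma run_neighbours (v : 'I_n) c (I : nat -> state -> Prop) s :
  (forall j s1, I j s1 -> [/\ reads_input s1, reg s1 rU = v & reg s1 rJ = off v + j]) ->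
  (forall j s1, j < size (adj v) -> fits W s1 -> I j s1 -> run W c s1 (cost c) (I j.+1)) ->
  fits W s -> I 0 s ->
  run W (While more_neighbours c) s (size (adj v) * (cost c + 7) + 7) (I (size (adj v))).
Proof.
move=> at_v step fs Is.
have -> : size (adj v) * (cost c + 7) + 7 =
    \sum_(j < size (adj v)) (cost c + (expr_cost more_neighbours).+1) +
      (expr_cost more_neighbours).+1 by rewrite sum_nat_const card_ord.
apply: (run_while W_gt1 (f := fun=> cost c)) => // [j s1 lt_j fs1 Is1|s1 Is1].
  have [rd v_s j_s] := at_v _ _ Is1; have [ov ->] := more_neighboursP rd v_s j_s.
  by split=> //; apply: step.
have [rd v_s j_s] := at_v _ _ Is1; have [ov ->] := more_neighboursP rd v_s j_s.
by rewrite ltnn.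
Qed.

Definition visit_cost (deg : nat) : nat :=
  cost enter + (deg * (cost scan + 7) + 7 +
    (cost settle + (deg * (cost mark + 7) + 7 + cost leave))).

Lemma run_visit k s :
  k < n -> fits W s -> visited k s ->
  run W visit s (visit_cost (size (adj (nth r q k)))) (visited k.+1).
Proof.
move=> lt_k fs vis; have [u Eu] : exists u, nth r q k = u by exists (nth r q k).
rewrite Eu; apply: run_seq (run_enter lt_k Eu fs vis) _ => s1 fs1 scan1.
apply: run_seq (run_neighbours (I := scanned k u) (v := u) _ _ fs1 scan1) _.
- by move=> j s2 [[rd _ _ _] [_ [_ ? ?] _]].
- by move=> j s2 lt_j fs2; apply: run_scan.
move=> s2 fs2 scan2; apply: run_seq (run_settle lt_k Eu fs2 scan2) _ => s3 fs3 mark3.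
apply: run_seq (run_neighbours (I := marked k u) (v := u) _ _ fs3 mark3) _.
- by move=> j s4 [[rd _ _ _] [_ [_ ? ?] _ _]].
- by move=> j s4 lt_j fs4; apply: run_mark.
by move=> s4 fs4; apply: run_leave.
Qed.

Lemma bfs_all : bfs r adj n = q.
Proof. by rewrite /bfs_order card_ord. Qed.

Lemma sum_degrees_order : \sum_(k < n) size (adj (nth r q k)) = 2 * m.
Proof.
rewrite -(sum_degrees r e_median adjP).
have -> : \sum_u size (adj u) = \sum_(v <- q) size (adj v).
  by rewrite [RHS]big_uniq ?q_uniq //; apply: eq_bigl => v; rewrite q_mem.
by rewrite [RHS](big_nth r) q_size big_mkord.
Qed.

(** Degrees sum to [2 * m], and each list entry pays for two loop tests of 7, one in each pass; the
    outer test costs 4. *)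
Lemma run_visits s :
  fits W s -> visited 0 s ->
  run W (While (Bin Ltn (Reg rHead) (Reg rTail)) visit) s
    (n * (visit_cost 0 + 4) + 2 * m * (cost scan + cost mark + 14) + 4) (visited n).
Proof.
move=> fs vis.
have -> : n * (visit_cost 0 + 4) + 2 * m * (cost scan + cost mark + 14) =
    \sum_(k < n) (visit_cost (size (adj (nth r q k))) + 4).
  rewrite -sum_degrees_order big_distrl -[X in X * _ + _](card_ord n) -sum_nat_const -big_split.
  by apply: eq_bigr => k _; rewrite /visit_cost /=; nia.
apply: (run_while W_gt1 (f := fun k => visit_cost (size (adj (nth r q k)))))
  => // [k s1 lt_k fs1 vis1|s1 [_ _ _ [tail1 _ _] [_ hd1 _]]].
  have [_ _ _ [tail1 _ _] [_ hd1 _]] := vis1.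
  rewrite /= hd1 tail1; split=> //; last exact: run_visit.
  by rewrite (bfs_lt_size r e_median adjP) // card_ord.
by rewrite /= hd1 tail1 bfs_all q_size ltnn.
Qed.

Lemma run_start :
  run W start (input adj) (cost start) (visited 0).
Proof.
have [? ? ? ?] := W_bounds.
have [n_s off_s adj_s] := input_reads.
apply: run_vc => //; first exact: input_fits.
split=> //; split; [exact: ltnW | exact: W_gt1 |].
split=> //; first by split=> // v; rewrite take0.
- by move=> v w; rewrite take0.
- split=> [//|[|//] _ /=|v]; first by rewrite r0.
  rewrite take0 in_nil /= /upd /= inE -[v == r]/(v == r :> nat) r0.
  by case: (_ == _).
- by split; rewrite //= take0.
Qed.

(** * Copying the labels to the output bank *)

Definition copied (a : nat) (s : state) : Prop :=
  [/\ reads_input s, reg s rCount = size (gates e r q), matrix n s,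
      forall v : 'I_n, bank s bRow v = row v
    & forall (v : 'I_n) i, i < size (adj v) -> off v + i < a ->
        bank s bOut (off v + i) = edge_label v (nth r (adj v) i)].

Lemma slot_inj (v w : 'I_n) i j :
  i < size (adj v) -> j < size (adj w) -> off v + i = off w + j ->
  v = w /\ i = j.
Proof.
rewrite -!nth_shape => lt_i lt_j E.
have := flatten_indexKl lt_i; have := flatten_indexKr lt_i.
rewrite /flatten_index -!/(off _) E.
rewrite [reshape_offset _ _](flatten_indexKr lt_j) [reshape_index _ _](flatten_indexKl lt_j).
by move=> -> /val_inj ->.
Qed.

Definition copying (v : 'I_n) (j : nat) (s : state) : Prop :=
  [/\ copied (off v + j) s, reg s rU = v & reg s rJ = off v + j].

Lemma run_copy v j s :
  j < size (adj v) -> fits W s -> copying v j s ->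
  run W copy s (cost copy) (copying v j.+1).
Proof.
move=> lt_j fs [[[n_s off_s adj_s] cnt_s mat_s row_s out_s] v_s j_s].
have [? ? ? ?] := W_bounds; have le_s := slot_bound lt_j.
have Ew := adj_s v j lt_j; set w := nth r (adj v) j in Ew.
have vw : e v w by rewrite -(adjP v).2 mem_nth.
apply: run_vc => //=; rewrite /upd /= v_s j_s Ew row_s -/(addr v w).
split=> //; first by split=> //; apply: addr_lt.
split; first by split=> //; lia.
have E : bank s bMatrix (addr v w) = edge_label v w.
  by apply: mat_s => //; rewrite take_oversize ?q_size ?q_mem.
rewrite E; split=> //; last by rewrite /= /upd /= addn1 addnS.
split=> // x i lt_i lt_a /=; rewrite /upd /=.
case: eqP => [/(slot_inj lt_i lt_j)[-> ->]|ne] //.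
by apply: out_s => //; move: lt_a; rewrite addnS ltnS leq_eqVlt => /predU1P[].
Qed.

(** The 15 per vertex is the last inner test, 7, the increment, 4, and the outer test, 4. *)
Lemma run_copies s :
  fits W s -> reg s rU = 0 -> reg s rJ = 0 -> copied 0 s ->
  run W (While (Bin Ltn (Reg rU) (Reg rN))
          (Seq (While more_neighbours copy) (incr rU))) s
    (n * 15 + 2 * m * (cost copy + 7) + 4) (copied (off n)).
Proof.
move=> fs U0 J0 cp; have [? ? ? ?] := W_bounds.
pose I v s := [/\ copied (off v) s, reg s rU = v & reg s rJ = off v].
pose f v := size (nth [::] (lists adj) v) * (cost copy + 7) + 7 + cost (incr rU).
have Ef (v : 'I_n) : size (nth [::] (lists adj) v) = size (adj v).
  by rewrite nth_lists size_map.
have -> : n * 15 + 2 * m * (cost copy + 7) = \sum_(v < n) (f v + 4).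
  rewrite -(sum_degrees r e_median adjP) big_distrl.
  rewrite -[X in X * _ + _](card_ord n) -sum_nat_const -big_split.
  by apply: eq_bigr => v _; rewrite /f Ef /=; lia.
have loop : run W (While (Bin Ltn (Reg rU) (Reg rN))
          (Seq (While more_neighbours copy) (incr rU))) s (\sum_(v < n) (f v + 4) + 4) (I n).
  apply: (run_while W_gt1 (f := f))
    => // [v0 s1 lt_v fs1 [cp1 u1 j1]|s1 [[[n1 _ _] _ _ _ _] u1 _]|]; last by rewrite /I /off take0.
    pose v := Ordinal lt_v; have [[n1 _ _] _ _ _ _] := cp1.
    rewrite /= u1 n1; split=> //; rewrite /f -[v0]/(v : nat) Ef.
    apply: run_seq (run_neighbours (I := copying v) (v := v) _ _ fs1 _) _.
    - by move=> j s2 [[rd _ _ _ _] ? ?].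
    - by move=> j s2 lt_j fs2; apply: run_copy.
    - by split; rewrite ?addn0.
    move=> s2 fs2 [cp2 u2 j2]; apply: run_vc => //=; rewrite u2.
    split; first by split=> //=; have := ltn_ord v; lia.
    rewrite /I -[v0.+1]/(v.+1) offS; split=> //=.
    by rewrite /upd /= addn1.
  by rewrite /= u1 n1 ltnn.
by apply: run_weaken loop _ _ => // s' [].
Qed.

(** The 21 adds the loop tests of the three passes. The 31 exceeds 4 + 15 per vertex plus the two
    outer exit tests; [n <= m.+1] does the rest. *)
Lemma run_prog :
  exists s t, [/\ exec W theta_classes_prog (input adj) s t,
    t <= (cost start + visit_cost 0 + cost rewind + 31 +
          2 * (cost scan + cost mark + cost copy + 21)) * m.+1 & copied (off n) s].
Proof.
have W1 := W_gt1; have [? ? ? ?] := W_bounds.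
have [s [t [ex le_t _ cp]]] : run W theta_classes_prog (input adj)
    (cost start + (n * (visit_cost 0 + 4) + 2 * m * (cost scan + cost mark + 14) + 4 +
      (cost rewind + (n * 15 + 2 * m * (cost copy + 7) + 4)))) (copied (off n)).
  apply: run_seq run_start _ => s1 fs1 vis1.
  apply: run_seq (run_visits fs1 vis1) _ => s2 fs2 [rd2 [_ rp2] mat2 _ [cnt2 _ _]].
  have q_take : take n q = q by rewrite take_oversize ?q_size.
  apply: (@run_seq _ _ _ _ _ _ (fun s3 => [/\ reg s3 rU = 0, reg s3 rJ = 0 & copied 0 s3])).
    apply: run_vc => //=; split; first by lia.
    split; first by lia.
    split=> //; split=> //; first by rewrite /= /upd /= cnt2 q_take.
    by move=> v; have [] := rp2 v; rewrite // q_take q_mem.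
  by move=> s3 fs3 [U3 J3 cp3]; apply: run_copies.
exists s, t; split=> //; apply: leq_trans le_t _.
have le_n : n <= m.+1 by rewrite -[X in X <= _](card_ord n); apply: card_vertices_le r e_median.
have := leq_mul le_n (leqnn (visit_cost 0 + 19)).
move: (visit_cost 0) (cost start) (cost scan) (cost mark) (cost copy) (cost rewind) => *; lia.
Qed.

(** * From edge labels to the partition *)

Lemma label_edge_label u v : v \in below u ->
  edge_label u v = label u v /\ edge_label v u = label u v.
Proof.
move=> vu; have [uv _] := belowP e_median vu.
by rewrite -(edge_labelC uv) /edge_label vu.
Qed.

Lemma output_label s v w :
  copied (off n) s -> e v w -> bank s bOut (slot adj v w) = edge_label v w.
Proof.
move=> [_ _ _ _ out_s] vw; have wv : w \in adj v by rewrite (adjP v).2.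
have lt_i : index w (adj v) < size (adj v) by rewrite index_mem.
rewrite -[in RHS](nth_index r wv) -out_s //.
by apply: leq_trans (leq_off (ltn_ord v)); rewrite offS ltn_add2l.
Qed.

Lemma labelled_classP s i x : copied (off n) s ->
  reflect (exists u v, [/\ v \in below u, label u v = i & x = [set u; v]])
    (x \in labelled_class e adj s i).
Proof.
move=> cp; have out := output_label cp.
apply: (iffP imset2P) => [[v w _]|[u [v [vu Li ->]]]].
  rewrite inE => /andP[vw /eqP]; rewrite out // => Li ->.
  have [wv|vw'] := edge_orient r e_median vw.
    by exists v, w; split=> //; rewrite -Li; have [->] := label_edge_label wv.
  by exists w, v; rewrite setUC; split=> //; rewrite -Li; have [_ ->] := label_edge_label vw'.
have [uv _] := belowP e_median vu.
exists u v; rewrite // inE; apply/andP; split=> //; apply/eqP.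
by rewrite out //; have [->] := label_edge_label vu.
Qed.

Lemma copied_output s : copied (off n) s -> outputs_partition e adj s (Theta_classes e).
Proof.
move=> cp; have [_ cnt_s _ _ out_s] := cp.
have class_eq u v : v \in below u ->
    labelled_class e adj s (label u v) =
      [set y in edges e | Theta e [set u; v] y].
  move=> vu; apply/setP => y; rewrite inE; apply/(labelled_classP _ _ cp)/andP.
    move=> [a [b [ba Li ->]]]; split; first by apply/(edgesP r e_median); exists a, b.
    by rewrite (Theta_half e_median vu ba) (label_inj e_median q_mem ba vu Li).
  case=> /(edgesP r e_median)[a [b [ba ->]]].
  rewrite (Theta_half e_median vu ba) => /eqP E; exists a, b; split=> //.
  by rewrite !labelE E.
have classes : [set labelled_class e adj s i | i : 'I_(reg s rCount)] = Theta_classes e.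
  apply/setP => X; apply/imsetP/imsetP => [[i _ ->]|[x /(edgesP r e_median)[u [v [vu ->]]] ->]].
    have lt_i : i < size (gates e r q) by rewrite -cnt_s.
    have [u [v [vu <-]]] := label_surj e_median q_uniq lt_i.
    by exists [set u; v]; [apply/(edgesP r e_median); exists u, v | exact: class_eq].
  have lt_l : label u v < reg s rCount by rewrite cnt_s; apply: (label_lt e_median q_mem vu).
  by exists (Ordinal lt_l) => //=; rewrite class_eq.
split=> // [v w vw|].
  rewrite (output_label cp vw) cnt_s.
  have [wv|vw'] := edge_orient r e_median vw.
    by have [-> _] := label_edge_label wv; apply: (label_lt e_median q_mem wv).
  by have [_ ->] := label_edge_label vw'; apply: (label_lt e_median q_mem vw').
(* Every label is used by some edge, and an edge in two labelled classes has both labels, so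
   distinct labels give distinct classes. *)
rewrite -classes card_imset ?card_ord // => i j Eij; apply: val_inj.
have lt_i : i < size (gates e r q) by rewrite -cnt_s.
have [u [v [vu Li]]] := label_surj e_median q_uniq lt_i.
have /(labelled_classP _ _ cp)[a [b [ba Lj E]]] : [set u; v] \in labelled_class e adj s j.
  by rewrite -Eij; apply/(labelled_classP _ _ cp); exists u, v.
by have [Eu Ev] := below_pair_inj e_median vu ba E; rewrite /= -Li -Lj Eu Ev.
Qed.

End Correctness.

(* The words have O(log (n + m)) bits: their values are below (n + m + 2)^d. *)
Theorem theorem4p8 :
  exists (prog : cmd) (c d : nat),
  forall (n : nat) (e : rel 'I_n) (adj : 'I_n -> seq 'I_n),
    median_graph e -> adjacency_lists e adj ->
    let m := #|edges e| in
    exists (s : state) (t : nat),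
      [/\ exec ((n + m).+2 ^ d) prog (input adj) s t,
          t <= c * m.+1
        & outputs_partition e adj s (Theta_classes e)].
Proof.
(* The constant [c] is left open and determined by the bound of [run_prog]. *)
exists theta_classes_prog; eexists; exists 2 => n e adj e_median adjP /=.
have n_gt0 : 0 < n by have [[]] := e_median; rewrite card_ord.
have [s [t [ex le_t cp]]] :=
  run_prog (r := Ordinal n_gt0) e_median adjP (erefl 0) (leqnn _).
exists s, t; split; [exact: ex | exact: le_t |].
exact: (copied_output (r := Ordinal n_gt0) e_median adjP (erefl 0) (leqnn _) cp).
Qed.
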